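(* Let $T$ be an $\mathbb{F}$-stopping time and $S$ a $\mathbb{G}$-stopping time with $S\ge\tau$ almost surely. If there exists an $s\mathcal{H}$-measure over $(S,T]$, then $[S,T)\in\mathcal{L}^o$.
   Context: Let $(\Omega,\mathcal{A},\mathbb{Q})$ be a probability space with a right-continuous filtration $\mathbb{F}=(\mathcal{F}_t)_{t\ge0}$ such that $\mathcal{F}_0$ contains $\mathcal{N}^{\mathcal{F}_\infty}$, where for a $\sigma$-algebra $\mathcal{T}\subset\mathcal{A}$, $\mathcal{N}^{\mathcal{T}}$ denotes the $\sigma$-algebra generated by all subsets of $\mathcal{T}$-measurable $\mathbb{Q}$-null sets. Let $\tau$ be a random variable with values in $[0,\infty]$, let $\mathcal{N}=\mathcal{N}^{\sigma(\tau)\vee\mathcal{F}_\infty}$, and let $\mathbb{G}=(\mathcal{G}_t)_{t\ge0}$ with $\mathcal{G}_t=\mathcal{N}\vee\bigcap_{s>t}(\mathcal{F}_s\vee\sigma(\tau\wedge s))$. Identities are understood up to $\mathcal{N}$-measurable $\mathbb{Q}$-null sets. $\mathcal{L}^o$ is the family of $\mathbb{G}$-optional sets $A$ such that for every $\mathbb{G}$-optional $Y$ there exist $Y'\in\mathcal{O}(\mathbb{F})$ and a $\mathcal{B}[0,\infty]\otimes\mathcal{O}(\mathbb{F})$-measurable $Y''$ on $[0,\infty]\times(\mathbb{R}_+\times\Omega)$ with $Y\mathbf{1}_A=(Y'\mathbf{1}_{[0,\tau)}+Y''(\tau)\mathbf{1}_{[\tau,\infty)})\mathbf{1}_A$, where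 $Y''(\tau)(t,\omega)=Y''(\tau(\omega),t,\omega)$. For $\mathbb{G}$-stopping times $S,T$, a probability measure $\mathbb{Q}'$ on $\mathcal{G}_\infty$ is an $s\mathcal{H}$-measure over $(S,T]$ (with respect to $(\mathbb{Q},\mathbb{F},\mathbb{G})$) if $\mathbb{Q}'$ is equivalent to $\mathbb{Q}$ on $\mathcal{G}_\infty$ and, for every $(\mathbb{Q},\mathbb{F})$-local martingale $X$, the process $X^{(S,T]}_t=X_{(S\vee T)\wedge t}-X_{S\wedge t}$, $t\ge0$, is a $(\mathbb{Q}',\mathbb{G})$-local martingale. *)

(* Defs.v *)
From HB Require Import structures.
From mathcomp Require Import all_boot all_order all_algebra.
From mathcomp Require Import all_classical all_reals all_analysis measurable_realfun lebesgue_measure.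
Set Implicit Arguments. Unset Strict Implicit. Unset Printing Implicit Defensive.
Import Order.TTheory GRing.Theory Num.Theory.
Import numFieldNormedType.Exports.
Local Open Scope classical_set_scope.
Local Open Scope ring_scope.

Section defs.
Context {R : realType}.

Definition Rpos : set R := [set t | 0 <= t].
Definition Dpos {T : Type} : set (R * T) := [set p | 0 <= p.1].

Definition sjoin {T : Type} (F G : set (set T)) : set (set T) := <<s F `|` G >>.

Definition sigma_rv {T : Type} (f : T -> \bar R) : set (set T) :=
  [set E | exists B : set (\bar R), measurable B /\ E = f @^-1` B].

Definition Qnull {d} {T : measurableType d} (Q : {measure set T -> \bar R})
  (A : set T) : Prop :=
  exists B, measurable B /\ (Q B = 0)%E /\ A `<=` B.

Definition nullsigma {d} {T : measurableType d} (Q : {measure set T -> \bar R})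
  (Tc : set (set T)) : set (set T) :=
  <<s [set B | exists A, Tc A /\ measurable A /\ (Q A = 0)%E /\ B `<=` A] >>.

Definition sinfty {T : Type} (F : R -> set (set T)) : set (set T) :=
  <<s \bigcup_(t in Rpos) F t >>.

Definition good_filtration {d} {T : measurableType d}
  (Q : {measure set T -> \bar R}) (F : R -> set (set T)) : Prop :=
  [/\ (forall t, 0 <= t -> sigma_algebra setT (F t) /\ F t `<=` measurable),
      (forall s t, 0 <= s -> s <= t -> F s `<=` F t),
      (forall t, 0 <= t -> F t = \bigcap_(s in [set s | t < s]) F s) &
      nullsigma Q (sinfty F) `<=` F 0].

Definition Nsig {d} {T : measurableType d} (Q : {measure set T -> \bar R})
  (F : R -> set (set T)) (tau : T -> \bar R) : set (set T) :=
  nullsigma Q (sjoin (sigma_rv tau) (sinfty F)).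

Definition Gfilt {d} {T : measurableType d} (Q : {measure set T -> \bar R})
  (F : R -> set (set T)) (tau : T -> \bar R) (t : R) : set (set T) :=
  sjoin (Nsig Q F tau)
    (\bigcap_(s in [set s | t < s])
        sjoin (F s) (sigma_rv (fun w => Order.min (tau w) s%:E))).

Definition Ginf {d} {T : measurableType d} (Q : {measure set T -> \bar R})
  (F : R -> set (set T)) (tau : T -> \bar R) : set (set T) :=
  sinfty (Gfilt Q F tau).

Definition stopping_time {T : Type} (H : R -> set (set T)) (S : T -> \bar R) : Prop :=
  (forall w, (0 <= S w)%E) /\
  (forall t, 0 <= t -> H t [set w | (S w <= t%:E)%E]).

Definition optional {T : Type} (H : R -> set (set T)) : set (set (R * T)) :=
  <<s Dpos, [set [set p | 0 <= p.1 /\ (S p.2 <= p.1%:E)%E] | S in stopping_time H] >>.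

Definition Dprod {T : Type} : set (\bar R * (R * T)) :=
  [set q | (0 <= q.1)%E /\ 0 <= q.2.1].
Definition borel_optional {T : Type} (H : R -> set (set T)) : set (set (\bar R * (R * T))) :=
  <<s Dprod, [set E | exists B C, measurable B /\ B `<=` [set u | (0 <= u)%E] /\
              optional H C /\ E = [set q | B q.1 /\ C q.2]] >>.

Definition mble_wrt {U : Type} (D : set U) (Sg : set (set U)) (f : U -> R) : Prop :=
  forall B : set R, measurable B -> Sg (D `&` f @^-1` B).

Definition Lo {d} {T : measurableType d} (Q : {measure set T -> \bar R})
  (F : R -> set (set T)) (tau : T -> \bar R) (A : set (R * T)) : Prop :=
  A `<=` Dpos /\ optional (Gfilt Q F tau) A /\
  forall Y : R * T -> R, mble_wrt Dpos (optional (Gfilt Q F tau)) Y ->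
  exists (Y' : R * T -> R) (Y'' : \bar R * (R * T) -> R),
    mble_wrt Dpos (optional F) Y' /\ mble_wrt Dprod (borel_optional F) Y'' /\
    exists M, Nsig Q F tau M /\ Qnull Q M /\
      forall w, ~ M w -> forall t, 0 <= t ->
        Y (t, w) * (\1_A (t, w)) =
        (Y' (t, w) * (\1_[set p : R * T | (p.1%:E < tau p.2)%E] (t, w))
         + Y'' (tau w, (t, w)) * (\1_[set p : R * T | (tau p.2 <= p.1%:E)%E] (t, w)))
        * (\1_A (t, w)).

Definition cadlag {T : Type} (X : R -> T -> R) : Prop :=
  forall w t, 0 <= t ->
    (X u w @[u --> t^'+] --> X t w) /\ (0 < t -> cvg (X u w @[u --> t^'-])).

Definition adapted {T : Type} (H : R -> set (set T)) (X : R -> T -> R) : Prop :=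
  forall t, 0 <= t -> forall B : set R, measurable B -> H t (X t @^-1` B).

Definition martingale {d} {T : measurableType d} (P : {measure set T -> \bar R})
  (H : R -> set (set T)) (X : R -> T -> R) : Prop :=
  adapted H X /\
  (forall t, 0 <= t -> P.-integrable setT (fun w => (X t w)%:E)) /\
  (forall s t, 0 <= s -> s <= t -> forall A, H s A ->
     (\int[P]_(w in A) (X t w)%:E = \int[P]_(w in A) (X s w)%:E)%E).

Definition stopped {T : Type} (S : T -> \bar R) (X : R -> T -> R) : R -> T -> R :=
  fun t w => X (fine (Order.min (S w) t%:E)) w.

Definition local_martingale {d} {T : measurableType d} (P : {measure set T -> \bar R})
  (H : R -> set (set T)) (X : R -> T -> R) : Prop :=
  cadlag X /\ adapted H X /\
  exists Tn : nat -> T -> \bar R,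
    (forall n, stopping_time H (Tn n)) /\
    (forall n w, (Tn n w <= Tn n.+1 w)%E) /\
    (exists Nl, measurable Nl /\ (P Nl = 0)%E /\
        forall w, ~ Nl w -> forall r : R, exists n, (r%:E <= Tn n w)%E) /\
    (forall n, martingale P H (stopped (Tn n) X)).

Definition stoch_int_proc {T : Type} (S U : T -> \bar R) (X : R -> T -> R) : R -> T -> R :=
  fun t w => X (fine (Order.min (Order.max (S w) (U w)) t%:E)) w
             - X (fine (Order.min (S w) t%:E)) w.

Definition sH_measure {d} {T : measurableType d} (Q : {measure set T -> \bar R})
  (F : R -> set (set T)) (tau : T -> \bar R) (S U : T -> \bar R)
  (Q' : probability (g_sigma_algebraType (Ginf Q F tau)) R) : Prop :=
  (forall A, Ginf Q F tau A -> ((Q' A = 0)%E <-> Qnull Q A)) /\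
  forall X : R -> T -> R, local_martingale Q F X ->
    local_martingale Q' (Gfilt Q F tau) (stoch_int_proc S U X).

End defs.
Arguments sH_measure {R d T} Q F tau S U Q'.

(* Main.v *)
Require Import Defs.
From HB Require Import structures.
From mathcomp Require Import all_boot all_order all_algebra.
From mathcomp Require Import all_classical all_reals all_analysis measurable_realfun lebesgue_measure.
From mathcomp Require Import ring lra.
Import Order.TTheory GRing.Theory Num.Theory.
Import numFieldNormedType.Exports.
Local Open Scope classical_set_scope.
Local Open Scope ring_scope.
Set Implicit Arguments. Unset Strict Implicit. Unset Printing Implicit Defensive.

(** On [[S, T)] we have [tau <= S <= t], so [tau] is known at time [t], and the
    [sH]-property says that an [F]-martingale [X] with [X_T = 1_C] satisfies
    [Q'(C | G_t) = X_t] there. Hence [Q'(C | G)] has on [[S, T)] a right-continuous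
    version of the form [Y''(tau)] when [C = {tau in V} /\ B /\ {s < T}] with [B] in
    [F_s]. Such [C] form a pi-system, and the class of all [C] with this property is
    a lambda-system: for a disjoint union, the maximal inequality makes the series of
    versions converge uniformly in time.

    For a [G]-stopping time [U], this applies to [C_q = {U <= q, U < T}]. On [[S, T)],
    outside a null set, [U <= t] if and only if [Q'(C_q | G_t) = 1] for all rational
    [q > t]; the converse implication holds because [C] contains almost all paths on
    which [Q'(C | G_t)] reaches 1. So [[U, oo)] is split on [[S, T)], and these sets
    generate the [G]-optional sigma-algebra. No section theorem is needed.

    The cadlag martingale [Q(C | F_t)] comes from Dubins' bound on downcrossings, and
    it is optional because [{X > b}] and [{X >= a}], [a < b], are separated by a
    countable union of stochastic intervals. *)

(** * Sigma-algebras and probabilities *)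

(** The obstacle is that a conditional probability is determined at each time only up to a null set,
    while the conclusion asks for one null set serving all times. Every estimate is therefore made
    at countably many rational times and carried to real times by right-continuity of paths. This is
    why right-continuity on [[S, T)] is part of [split_cprob] and has to survive countable unions.

    The martingales are computed under [Q] and used under [Q']: their value at [T] is identified off
    a [Q]-null set of F_infty, hence also [Q']-almost surely, and the local martingale property then
    compares a time [t] with a time after [s]. The factor [{s < T}] is what makes C settled at [T].
    It also forces [{U < T}] into C_q, because the generators see an event of G_p only through its
    traces on [{s < T}] with [s > p]. *)

Section sigma_algebra_closure.
Context {T : Type} (H : set (set T)) (HS : sigma_algebra setT H).

Lemma salg_set0 : H set0. Proof. by case: HS. Qed.

Lemma salg_setC A : H A -> H (~` A).
Proof. by case: HS => _ HC _ HA; rewrite -setTD; exact: HC. Qed.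

Lemma salg_setT : H setT.
Proof. by rewrite -setC0; exact: salg_setC salg_set0. Qed.

Lemma salg_bigcup (A : nat -> set T) : (forall i, H (A i)) -> H (\bigcup_i A i).
Proof. by case: HS => _ _; exact. Qed.

Lemma salg_bigcap (A : nat -> set T) : (forall i, H (A i)) -> H (\bigcap_i A i).
Proof.
move=> HA; rewrite -[X in H X]setCK setC_bigcap; apply: salg_setC.
by apply: salg_bigcup => i; exact: salg_setC.
Qed.

Lemma salg_bigcup_in (P : set nat) (A : nat -> set T) :
  (forall i, P i -> H (A i)) -> H (\bigcup_(i in P) A i).
Proof.
move=> HA; rewrite bigcup_mkcond; apply: salg_bigcup => i.
by case: ifPn => [/set_mem|_]; [exact: HA|exact: salg_set0].
Qed.

Lemma salg_setU A B : H A -> H B -> H (A `|` B).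
Proof.
by move=> HA HB; rewrite -bigcup2E; apply: salg_bigcup => -[|[|i]] //=; exact: salg_set0.
Qed.

Lemma salg_setI A B : H A -> H B -> H (A `&` B).
Proof.
move=> HA HB; rewrite -[X in H X]setCK setCI; apply: salg_setC.
by apply: salg_setU; exact: salg_setC.
Qed.

Lemma salg_setD A B : H A -> H B -> H (A `\` B).
Proof. by move=> HA HB; rewrite setDE; apply: salg_setI => //; exact: salg_setC. Qed.

End sigma_algebra_closure.

Lemma gsalg {T : Type} (G : set (set T)) : sigma_algebra setT <<s G >>.
Proof. exact: smallest_sigma_algebra. Qed.

Lemma gsalg_sub {T : Type} (D : set T) (G C : set (set T)) :
  sigma_algebra D C -> G `<=` C -> <<s D, G >> `<=` C.
Proof. by move=> sC GC; exact: smallest_sub. Qed.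

Section rational_enumeration.
Context {R : realType}.

(** The absolute value keeps the dense sequence inside [[0, +oo[], where the filtration hypotheses
    apply. *)
Definition qenum (n : nat) : R :=
  if unpickle n is Some q then `|ratr (q : rat)| else 0.

Lemma qenum_ge0 n : 0 <= qenum n.
Proof. by rewrite /qenum; case: unpickle. Qed.

Lemma qenum_dense (a b : R) : 0 <= a -> a < b -> exists n, a < qenum n < b.
Proof.
move=> a0 ab; have [q] := rat_in_itvoo ab; rewrite in_itv /= => /andP[aq qb].
exists (pickle q); rewrite /qenum pickleK ger0_norm ?aq//.
by rewrite ltW// (le_lt_trans a0).
Qed.

End rational_enumeration.

Section real_valued_probability.
Context {R : realType} {d} {T : measurableType d} (P : probability T R).
Implicit Types A B C : set T.

Definition pr A : R := fine (P A).

Lemma prE A : measurable A -> P A = (pr A)%:E.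
Proof. by move=> mA; rewrite /pr fineK// fin_num_measure. Qed.

Lemma pr_ge0 A : 0 <= pr A.
Proof. by rewrite /pr fine_ge0. Qed.

Lemma pr_eq0 A : measurable A -> pr A = 0 <-> P A = 0%E.
Proof. by move=> mA; rewrite prE//; split => [->//|[]]. Qed.

Lemma pr0 : pr set0 = 0. Proof. by rewrite /pr measure0. Qed.

Lemma pr_le A B : measurable A -> measurable B -> A `<=` B -> pr A <= pr B.
Proof. by move=> mA mB AB; rewrite -lee_fin -!prE// le_measure// inE. Qed.

Lemma pr_le1 A : measurable A -> pr A <= 1.
Proof. by move=> mA; rewrite -lee_fin -prE//; exact: probability_le1. Qed.

Lemma pr_split A B : measurable A -> measurable B ->
  pr A = pr (A `&` B) + pr (A `\` B).
Proof.
move=> mA mB; apply: EFin_inj; rewrite EFinD -!prE//; last 2 first.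
- exact: measurableD.
- exact: measurableI.
by rewrite (measureDI P mA mB) addeC.
Qed.

Lemma pr_bigcup_le (A : nat -> set T) (c : R) : (forall n, measurable (A n)) ->
  nondecreasing_seq A -> (forall n, pr (A n) <= c) -> pr (\bigcup_n A n) <= c.
Proof.
move=> mA ndA Ac; rewrite -lee_fin -prE; last exact: bigcup_measurable.
have cvgA : (P \o A) n @[n --> \oo] --> P (\bigcup_n A n).
  by apply: nondecreasing_cvg_mu => //; exact: bigcup_measurable.
rewrite -(cvg_lim _ cvgA)//; apply: lime_le; first by apply/cvg_ex; eexists; exact: cvgA.
by near=> n; rewrite /= prE// lee_fin.
Unshelve. all: by end_near. Qed.

Lemma pr_bigcap0 (A : nat -> set T) : (forall n, measurable (A n)) ->
  (forall e : R, 0 < e -> exists n, pr (A n) <= e) -> P (\bigcap_n A n) = 0%E.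
Proof.
move=> mA Ae; have mcap : measurable (\bigcap_n A n) by exact: bigcapT_measurable.
apply/pr_eq0 => //; apply/eqP; rewrite eq_le pr_ge0 andbT; apply/ler_addgt0Pr => e /Ae[n Ane].
rewrite add0r; apply: le_trans Ane; apply: pr_le => //.
by move=> w /(_ n I).
Qed.

Lemma integral_ge_cst A (f : T -> \bar R) (r c : R) : measurable A -> measurable_fun A f ->
  0 <= r -> (forall w, A w -> (r%:E <= f w)%E) ->
  (\int[P]_(w in A) f w = c%:E)%E -> r * pr A <= c.
Proof.
move=> mA mf r0 rf fc; rewrite -lee_fin -fc EFinM -prE// -integral_cst//.
by apply: ge0_le_integral.
Qed.

Lemma integral_le_cst A (f : T -> \bar R) (r c : R) : measurable A -> measurable_fun A f ->
  (forall w, A w -> (0 <= f w <= r%:E)%E) ->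
  (\int[P]_(w in A) f w = c%:E)%E -> c <= r * pr A.
Proof.
move=> mA mf fr fc; rewrite -lee_fin -fc EFinM -prE// -integral_cst//.
by apply: ge0_le_integral => // w /fr/andP[].
Qed.

End real_valued_probability.

(** * Conditional probabilities *)

Lemma measurable_gsalgE {T : pointedType} (H : set (set T)) (A : set T) :
  sigma_algebra setT H ->
  @measurable _ (g_sigma_algebraType H) A <-> H A.
Proof. by move=> HS; rewrite measurable_g_measurableTypeE. Qed.

Lemma measurable_fun_gsalgS {d'} {T : pointedType} {U : measurableType d'}
    (H K : set (set T)) (D : set T) (f : T -> U) :
  sigma_algebra setT H -> sigma_algebra setT K -> H D -> H `<=` K ->
  @measurable_fun _ _ (g_sigma_algebraType H) U D f ->
  @measurable_fun _ _ (g_sigma_algebraType K) U D f.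
Proof.
move=> HS KS HD HK mf mD B mB; apply/measurable_gsalgE => //; apply: HK.
by apply/measurable_gsalgE => //; apply: mf => //; exact/measurable_gsalgE.
Qed.

Lemma measurable_fun_gsalg {d d'} {T : measurableType d} {U : measurableType d'}
    (H : set (set T)) (D : set T) (f : T -> U) :
  sigma_algebra setT H -> H D -> H `<=` measurable ->
  @measurable_fun _ _ (g_sigma_algebraType H) U D f -> measurable_fun D f.
Proof.
move=> HS HD HK mf mD B mB; apply: HK.
by apply/measurable_gsalgE => //; apply: mf => //; exact/measurable_gsalgE.
Qed.

Lemma measure_bigcup0 {R : realType} {d} {T : measurableType d} (P : probability T R)
    (A : nat -> set T) :
  (forall n, measurable (A n)) -> (forall n, P (A n) = 0%E) -> P (\bigcup_n A n) = 0%E.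
Proof.
move=> mA A0; apply/(negligibleP _ (bigcup_measurable (fun k _ => mA k))).
apply: negligible_bigcup => n; apply/(negligibleP _ (mA n)); exact: A0.
Qed.

Section conditional_probability.
Context {R : realType} {d} {T : measurableType d} (P : probability T R).
Implicit Types (H : set (set T)) (D C A : set T) (f : T -> \bar R).

(** Localized to [D]: everything for the [F]-martingales, a time section of [[S, T)] for [G]. Values
    are extended reals so that infinite sums qualify before truncation at 1. *)
Definition cprob_on H D C f :=
  [/\ @measurable_fun _ _ (g_sigma_algebraType H) _ D f,
      (forall w, D w -> (0 <= f w)%E) &
      forall A, H A -> A `<=` D -> (\int[P]_(w in A) f w = P (A `&` C))%E].

Context H (HS : sigma_algebra setT H) (HM : H `<=` measurable) D (HD : H D).
Context C (mC : measurable C).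

Lemma cprob_on_measurable f A : cprob_on H D C f -> H A -> A `<=` D -> measurable_fun A f.
Proof.
move=> [mf _ _] HA AD.
apply: measurable_funS (measurable_fun_gsalg HS HD HM mf) => //; exact: HM.
Qed.

Lemma cprob_on_gt f (r : R) : cprob_on H D C f -> H (D `&` [set w | (r%:E < f w)%E]).
Proof.
move=> [mf _ _]; apply/measurable_gsalgE => //.
by apply: emeasurable_fun_o_infty => //; exact/measurable_gsalgE.
Qed.

Lemma cprob_on_ge f (r : R) : cprob_on H D C f -> H (D `&` [set w | (r%:E <= f w)%E]).
Proof.
move=> [mf _ _]; apply/measurable_gsalgE => //.
by apply: emeasurable_fun_c_infty => //; exact/measurable_gsalgE.
Qed.

Lemma cprob_on_le f (r : R) : cprob_on H D C f -> H (D `&` [set w | (f w <= r%:E)%E]).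
Proof.
move=> [mf _ _]; apply/measurable_gsalgE => //.
by apply: emeasurable_fun_infty_c => //; exact/measurable_gsalgE.
Qed.

Lemma cprob_on_ge_pr f (r : R) A : cprob_on H D C f -> 0 <= r -> H A -> A `<=` D ->
  (forall w, A w -> (r%:E <= f w)%E) -> r * pr P A <= pr P (A `&` C).
Proof.
move=> vf r0 HA AD rf; have mA := HM HA.
apply: (@integral_ge_cst _ _ _ _ _ f) => //; first exact: cprob_on_measurable.
by case: vf => _ _ -> //; rewrite prE//; exact: measurableI.
Qed.

Lemma cprob_on_le_pr f (r : R) A : cprob_on H D C f -> H A -> A `<=` D ->
  (forall w, A w -> (f w <= r%:E)%E) -> pr P (A `&` C) <= r * pr P A.
Proof.
move=> vf HA AD rf; have mA := HM HA.
apply: (@integral_le_cst _ _ _ _ _ f) => //; first exact: cprob_on_measurable.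
- by move=> w Aw; rewrite rf//; case: vf => _ -> //; exact: AD.
- by case: vf => _ _ -> //; rewrite prE//; exact: measurableI.
Qed.

(** A comparison of measures on all [H]-subsets becomes a pointwise bound: on [B n], where [f] is at
    least [r + 1/(n+1)], the two inequalities leave [pr (B n) / (n+1) <= 0]. The next lemma is the
    mirror image. *)
Lemma cprob_on_gt0 f (r : R) A : cprob_on H D C f -> 0 <= r -> H A -> A `<=` D ->
  (forall A', H A' -> A' `<=` A -> pr P (A' `&` C) <= r * pr P A') ->
  P (A `&` [set w | (r%:E < f w)%E]) = 0%E.
Proof.
move=> vf r0 HA AD rA.
pose B n := A `&` (D `&` [set w | ((r + n.+1%:R^-1)%:E <= f w)%E]).
have HB n : H (B n) by apply: salg_setI => //; exact: cprob_on_ge.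
have -> : A `&` [set w | (r%:E < f w)%E] = \bigcup_n B n.
  apply/seteqP; split => [w [Aw /= rf]|w [n _ [Aw [_ /= rf]]]].
    move: rf; case fw : (f w) => [x||] rf //.
    - have xr : 0 < x - r by rewrite subr_gt0 -lte_fin.
      have [n nx] := ltr_add_invr xr.
      exists n => //; split => //; split; first exact: AD.
      by rewrite /= fw lee_fin -lerBrDl ltW// -[ltLHS]add0r.
    - by exists 0%N => //; split => //; split; [exact: AD|rewrite /= fw leey].
  by split => //=; apply: lt_le_trans rf; rewrite lte_fin ltrDl invr_gt0.
apply: measure_bigcup0 => n; first exact/HM/HB.
apply/pr_eq0; first exact/HM/HB.
have BA : B n `<=` A by move=> w [].
have n0 : 0 < n.+1%:R^-1 :> R by rewrite invr_gt0.
have h1 : (r + n.+1%:R^-1) * pr P (B n) <= pr P (B n `&` C).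
  apply: (cprob_on_ge_pr vf) => //; first by rewrite addr_ge0// ltW.
  - by move=> w /BA /AD.
  - by move=> w [_ []].
have h2 := rA _ (HB n) BA.
have p0 := pr_ge0 P (B n).
have := le_trans h1 h2; rewrite mulrDl gerDl.
by rewrite pmulr_rle0// => ?; apply/eqP; rewrite eq_le; apply/andP.
Qed.

Lemma cprob_on_lt0 f (r : R) A : cprob_on H D C f -> H A -> A `<=` D ->
  (forall A', H A' -> A' `<=` A -> r * pr P A' <= pr P (A' `&` C)) ->
  P (A `&` [set w | (f w < r%:E)%E]) = 0%E.
Proof.
move=> vf HA AD rA.
pose B n := A `&` (D `&` [set w | (f w <= (r - n.+1%:R^-1)%:E)%E]).
have HB n : H (B n) by apply: salg_setI => //; exact: cprob_on_le.
have -> : A `&` [set w | (f w < r%:E)%E] = \bigcup_n B n.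
  apply/seteqP; split => [w [Aw /= rf]|w [n _ [Aw [_ /= rf]]]].
    have f0 : (0 <= f w)%E by case: vf => _ + _; apply; exact: AD.
    move: rf f0; case fw : (f w) => [x||] rf f0 //.
    have xr : 0 < r - x by rewrite subr_gt0 -lte_fin.
    have [n nx] := ltr_add_invr xr.
    exists n => //; split => //; split; first exact: AD.
    by rewrite /= fw lee_fin lerBrDl -lerBrDr ltW// -[ltLHS]add0r.
  by split => //=; apply: le_lt_trans rf _; rewrite lte_fin ltrBlDr ltrDl invr_gt0.
apply: measure_bigcup0 => n; first exact/HM/HB.
apply/pr_eq0; first exact/HM/HB.
have BA : B n `<=` A by move=> w [].
have n0 : 0 < n.+1%:R^-1 :> R by rewrite invr_gt0.
have h1 : pr P (B n `&` C) <= (r - n.+1%:R^-1) * pr P (B n).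
  apply: (cprob_on_le_pr vf) => //; first by move=> w /BA /AD.
  by move=> w [_ []].
have h2 := rA _ (HB n) BA.
have p0 := pr_ge0 P (B n).
have := le_trans h2 h1; rewrite mulrBl lerBrDr gerDl.
by rewrite pmulr_rle0// => ?; apply/eqP; rewrite eq_le; apply/andP.
Qed.

(** By [cprob_on_gt0] with [r = 1], a version exceeds 1 only on a null set. This bounds both
    Radon-Nikodym densities and sums of series. *)
Lemma cprob_on_min1 f : cprob_on H D C f -> cprob_on H D C (fun w => mine (f w) 1%E).
Proof.
move=> vf; split.
- by case: vf => mf _ _; apply: measurable_mine.
- by move=> w Dw; rewrite le_min; apply/andP; split => //; case: vf => _ + _; apply.
move=> A HA AD; have [mf f0 <- //] := vf.
have mA := HM HA.
have mfA := cprob_on_measurable vf HA AD.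
apply: ge0_ae_eq_integral => //.
- exact: measurable_mine.
- by move=> w /AD Dw; rewrite le_min f0//=.
- by move=> w /AD /f0.
exists (A `&` [set w | (1%:E < f w)%E]); split.
- by apply: emeasurable_fun_o_infty.
- apply: (cprob_on_gt0 vf) => // A' HA' AA'; rewrite mul1r.
  by apply: pr_le => //; [apply: measurableI => //; exact: HM|exact: HM].
- move=> w /=.
  apply: contra_notP => nAw Aw; rewrite /mine; case: ltP => // f1.
  by apply/eqP; rewrite eq_le f1 leNgt; apply/negP => f1'; apply: nAw.
Qed.

End conditional_probability.

Section conditional_probability_exists.
Context {R : realType} {d} {T : measurableType d} (P : probability T R).

(** Radon-Nikodym density of the measure [nu] with respect to the restriction of [P] to [H]; the
    restriction is the image of [P] under the identity, seen as a map to the coarser measurable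
    space. *)
Lemma cprob_exists (H : set (set T)) (C : set T) :
  sigma_algebra setT H -> H `<=` measurable -> measurable C ->
  exists f : T -> R, (forall w, 0 <= f w <= 1) /\ cprob_on P H setT C (EFin \o f).
Proof.
move=> HS HM mC; pose TH := g_sigma_algebraType H.
have mTH (A : set TH) : measurable A -> d.-measurable (A : set T).
  by move=> /measurable_gsalgE => /(_ HS); exact: HM.
have mid : measurable_fun [set: T] (id : T -> TH).
  by move=> _ B /mTH; rewrite setTI.
pose idm : {mfun T >-> TH} := HB.pack (id : T -> TH) (isMeasurableFun.Build _ _ _ _ _ mid).
pose mu : probability TH R := distribution P idm.
pose nu (A : set TH) : \bar R := P ((A : set T) `&` C).
have nu0 : nu set0 = 0%E by rewrite /nu set0I measure0.
have nu_ge0 A : (0 <= nu A)%E by exact: measure_ge0.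
have nu_add : semi_sigma_additive nu.
  move=> F mF tF mUF; rewrite /nu setI_bigcupl; apply: measure_semi_sigma_additive.
  - by move=> i; apply: measurableI => //; exact: mTH.
  - apply/trivIsetP => i j _ _ ij; rewrite setIACA setIid.
    by move/trivIsetP : tF => /(_ i j I I ij) ->; rewrite set0I.
  - by apply: bigcup_measurable => i _; apply: measurableI => //; exact: mTH.
pose nuM := isMeasure.Build _ _ _ nu nu0 nu_ge0 nu_add.
pose nuM' : {measure set TH -> \bar R} := HB.pack nu nuM.
have nufin : fin_num_fun nu.
  by move=> A mA; rewrite fin_num_measure//; apply: measurableI => //; exact: mTH.
pose nuF : {finite_measure set TH -> \bar R} :=
  HB.pack nu nuM (Measure_isFinite.Build _ _ _ nuM' nufin).
have dom : nuF `<< mu.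
  apply/null_content_dominatesP => A mA muA0.
  apply/eqP; rewrite eq_le measure_ge0 andbT -[leRHS]muA0.
  by apply: le_measure; rewrite ?inE//=; [apply: measurableI => //|]; exact: mTH.
have [f [f0 ffin fint nuf]] := radon_nikodym_sigma_finite dom.
have mf : measurable_fun [set: TH] f by exact: measurable_int fint.
have vf : cprob_on P H setT C f.
  split => // A HA _; have mA : measurable (A : set TH) by exact/measurable_gsalgE.
  rewrite -[RHS]/(nuF A) (nuf _ mA) (ge0_integral_pushforward mid)//.
  by apply: measurable_funTS.
have vg := cprob_on_min1 HS HM (salg_setT HS) mC vf.
exists (fun w => fine (mine (f w) 1%E)); split.
  move=> w; have fm : mine (f w) 1%E \is a fin_num.
    by rewrite /mine; case: ifP.
  by rewrite -!lee_fin fineK// ge_min le_min lexx f0 lee_fin ler01 orbT.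
rewrite (_ : EFin \o _ = fun w => mine (f w) 1%E)//.
by apply/funext => w /=; rewrite fineK// /mine; case: ifP.
Qed.

End conditional_probability_exists.

(** * Maximal inequality and downcrossings *)

Section rational_grids.
Context {R : realType}.

Lemma lt_sorted_subseq (l s : seq R) :
  sorted <%R l -> sorted <%R s -> {subset l <= s} -> subseq l s.
Proof.
move=> sl ss ls; have -> : l = [seq y <- s | y \in l].
  apply: lt_sorted_eq => //; first exact: lt_sorted_filter.
  by move=> x; rewrite mem_filter /=; case: (boolP (x \in l)) => //= /ls.
exact: filter_subseq.
Qed.

Definition qgrid (n : nat) : seq R := sort <=%R (undup (map qenum (iota 0 n))).

Lemma qgrid_sorted n : sorted <%R (qgrid n).
Proof. by rewrite sort_lt_sorted undup_uniq. Qed.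

Lemma mem_qgrid n (t : R) : (t \in qgrid n) = (t \in map qenum (iota 0 n)).
Proof. by rewrite mem_sort mem_undup. Qed.

Lemma qgrid_ge0 n (t : R) : t \in qgrid n -> 0 <= t.
Proof. by rewrite mem_qgrid => /mapP[k _ ->]; exact: qenum_ge0. Qed.

Lemma qgrid_subseq n m : (n <= m)%N -> subseq (qgrid n) (qgrid m).
Proof.
move=> nm; apply: lt_sorted_subseq; [exact: qgrid_sorted|exact: qgrid_sorted|].
move=> t; rewrite !mem_qgrid => /mapP[k]; rewrite mem_iota add0n => kn ->.
by apply: map_f; rewrite mem_iota add0n (leq_trans kn).
Qed.

Lemma qenum_subset_qgrid (l : seq R) : (forall t, t \in l -> exists n, t = qenum n) ->
  exists n, {subset l <= qgrid n}.
Proof.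
elim: l => [_|t l IH lq]; first by exists 0%N.
have [n ln] : exists n, {subset l <= qgrid n}.
  by apply: IH => u ul; apply: lq; rewrite inE ul orbT.
have [k tk] := lq t (mem_head _ _).
exists (maxn n k.+1) => u; rewrite inE => /predU1P[->|/ln].
  by rewrite mem_qgrid tk; apply: map_f; rewrite mem_iota leq_max ltnSn orbT.
by apply: mem_subseq; apply: qgrid_subseq; exact: leq_maxl.
Qed.

Lemma sorted_subseq_qgrid (l : seq R) : sorted <%R l ->
  (forall t, t \in l -> exists n, t = qenum n) -> exists n, subseq l (qgrid n).
Proof.
move=> sl /qenum_subset_qgrid[n ln]; exists n.
by apply: lt_sorted_subseq => //; exact: qgrid_sorted.
Qed.

End rational_grids.

Section maximal_inequality.
Context {R : realType} {d} {T : measurableType d} (P : probability T R).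
Context (H : R -> set (set T)).
Hypothesis HS : forall t : R, 0 <= t -> sigma_algebra setT (H t).
Hypothesis HM : forall t : R, 0 <= t -> H t `<=` measurable.
Hypothesis Hle : forall s t : R, 0 <= s -> s <= t -> H s `<=` H t.

Let hits (B : R -> set T) (l : seq R) := foldr (fun t E => B t `|` E) set0 l.

Let hitsP (B : R -> set T) (l : seq R) w : hits B l w <-> exists2 t, t \in l & B t w.
Proof.
elim: l => [|t l IH] /=; first by split => // -[].
split => [[Bt|/IH[u ul Bu]]|[u]].
- by exists t => //; rewrite mem_head.
- by exists u => //; rewrite inE ul orbT.
- by rewrite inE => /predU1P[->|ul Bu]; [left|right; apply/IH; exists u].
Qed.

(* The events [B t] are split according to the first time they occur, which is
   where adaptedness is used. *)
Lemma first_time_inequality (B : R -> set T) (C1 C2 : set T) (c1 c2 : R) :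
  measurable C1 -> measurable C2 -> 0 < c1 -> 0 <= c2 ->
  (forall t, 0 <= t -> H t (B t)) ->
  (forall t A, 0 <= t -> H t A -> A `<=` B t ->
    c1 * pr P (A `&` C1) <= c2 * pr P (A `&` C2)) ->
  c1 * pr P ((\bigcup_n B (qenum n)) `&` C1) <= c2 * pr P ((\bigcup_n B (qenum n)) `&` C2).
Proof.
move=> mC1 mC2 c10 c20 HB BC.
have mB t : 0 <= t -> measurable (B t) by move=> t0; apply: (HM t0); exact: HB.
have mhits l : (forall t, t \in l -> 0 <= t) -> measurable (hits B l).
  elim: l => [_|t l IH l0]; first exact: measurable0.
  rewrite [hits _ _]/=; apply: measurableU.
    by apply: mB; apply: l0; exact: mem_head.
  by apply: IH => u ul; apply: l0; rewrite inE ul orbT.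
have key l : forall h A, 0 <= h -> path <=%R h l -> H h A ->
    c1 * pr P (A `&` hits B l `&` C1) <= c2 * pr P (A `&` hits B l `&` C2).
  elim: l => [|t l IH] h A h0 /=.
    by rewrite !setI0 !set0I !pr0 !mulr0.
  move=> /andP[ht tl] HA; have t0 := le_trans h0 ht.
  have HtA : H t A by exact: Hle HA.
  have mA := HM t0 HtA.
  have l0 u : u \in l -> 0 <= u.
    move=> ul; apply: (le_trans t0).
    by have /allP := order_path_min le_trans tl; exact.
  have split_eq C : measurable C -> pr P (A `&` (B t `|` hits B l) `&` C) =
      pr P (A `&` B t `&` C) + pr P ((A `\` B t) `&` hits B l `&` C).
    move=> mC; rewrite (pr_split P _ (mB _ t0)).
      congr (pr P _ + pr P _); apply/seteqP; split => w /=.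
      - by move=> [[[]]].
      - by move=> [[Aw Bw] Cw]; split => //; split => //; split => //; left.
      - by move=> [[[Aw [Bw|hw]] Cw] nB]; [case: (nB Bw)|].
      - by move=> [[[Aw nB] hw] Cw]; split => //; split => //; split => //; right.
    by do 2 apply: measurableI => //; apply: measurableU; [exact: mB|exact: mhits].
  rewrite !split_eq// !mulrDr lerD//.
    apply: (BC t) => //.
    by apply: salg_setI; [exact: HS|exact: HtA|exact: HB].
  by apply: (IH t) => //; apply: salg_setD; [exact: HS|exact: HtA|exact: HB].
have bigcup_hits : \bigcup_n B (qenum n) = \bigcup_n hits B (qgrid n).
  apply/seteqP; split => w [n _].
    move=> Bw; exists n.+1 => //; apply/hitsP; exists (qenum n) => //.
    by rewrite mem_qgrid; apply: map_f; rewrite mem_iota add0n ltnSn.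
  move=> /hitsP[t]; rewrite mem_qgrid => /mapP[k _ ->] Bk.
  by exists k.
have mh n : measurable (hits B (qgrid n)).
  by apply: mhits => t; exact: qgrid_ge0.
rewrite bigcup_hits setI_bigcupl mulrC -ler_pdivlMr//.
apply: pr_bigcup_le.
- by move=> n; exact: measurableI.
- move=> n m nm; apply/subsetPset => w [/hitsP[t tn Bt] Cw]; split => //.
  by apply/hitsP; exists t => //; exact: (mem_subseq (qgrid_subseq nm)).
move=> n; rewrite ler_pdivlMr// mulrC.
have := key (qgrid n) 0 setT (lexx _); rewrite !setTI => /(_ _ (salg_setT (HS (lexx _)))).
rewrite path_min_sorted; last by apply/allP => t; exact: qgrid_ge0.
move=> /(_ (sub_sorted (fun x y => @ltW _ _ x y) (qgrid_sorted n))) /le_trans; apply.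
apply: ler_wpM2l => //; apply: pr_le => //.
- exact: measurableI.
- by apply: measurableI => //; exact: bigcup_measurable.
- by apply: setSI => w hw; exists n.
Qed.

End maximal_inequality.

Section downcrossings.
Context {R : realType} (a b : R).

(** The flag [above] is true while a descent below [a] is awaited; keeping it explicit allows
    induction on the list from either state. *)
Fixpoint downcross (above : bool) (l : seq R) : nat :=
  if l is x :: l' then
    if above then (if x < a then (downcross false l').+1 else downcross true l')
    else (if b < x then downcross true l' else downcross false l')
  else 0%N.

(** Being already above gains at most one downcrossing. Hence an extra value never lowers the count,
    whatever state it leads to, and counts increase along finer grids. *)
Lemma downcross_above l : (downcross false l <= downcross true l <= (downcross false l).+1)%N.
Proof.
elim: l => //= x l /andP[IH1 IH2].
by case: ifP => _; case: ifP => _; rewrite ?ltnS ?IH1 ?IH2 ?leqnn ?leqnSn.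
Qed.

Lemma downcross_cons s x l : (downcross s l <= downcross s (x :: l))%N.
Proof.
have /andP[h1 h2] := downcross_above l.
by case: s => /=; case: ifP.
Qed.

Lemma downcross_subseq s l l' : subseq l l' -> (downcross s l <= downcross s l')%N.
Proof.
elim: l' l s => [|x l' IH] [|y l] s //.
rewrite [subseq _ _]/=; case: eqP => [->|_] ll'; last first.
  exact: leq_trans (IH _ _ ll') (downcross_cons _ _ _).
by case: s => /=; case: ifP => _; rewrite ?ltnS IH.
Qed.

End downcrossings.

Section dubins.
Context {R : realType} {d} {T : measurableType d} (P : probability T R).
Context (H : R -> set (set T)).
Hypothesis HS : forall t : R, 0 <= t -> sigma_algebra setT (H t).
Hypothesis HM : forall t : R, 0 <= t -> H t `<=` measurable.
Hypothesis Hle : forall s t : R, 0 <= s -> s <= t -> H s `<=` H t.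
Context (C : set T) (mC : measurable C) (x : R -> T -> R).
Hypothesis xC : forall t : R, 0 <= t -> cprob_on P (H t) setT C (EFin \o x t).
Context (a b : R) (b0 : 0 <= b) (b1 : b <= 1) (ab : a < b).

Let N s (l : seq R) k := [set w | (k <= downcross a b s [seq x t w | t <- l])%N].

Let x_lt t : 0 <= t -> H t [set w | x t w < a].
Proof.
move=> t0; have HT := salg_setT (HS t0).
have := cprob_on_ge (HS t0) HT a (xC t0).
rewrite setTI => /(salg_setC (HS t0)); congr (H t _).
apply/seteqP; split => w /=; rewrite lee_fin ltNge; by [move/negP|move=> /negP].
Qed.

Let x_gt t : 0 <= t -> H t [set w | b < x t w].
Proof.
move=> t0; have HT := salg_setT (HS t0).
by have := cprob_on_gt (HS t0) HT b (xC t0); rewrite setTI.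
Qed.

(** [K] is arbitrary because two cases are used: all measurable sets, for the estimates, and
    [sinfty F], so that the exceptional null set belongs to every [F t]. *)
Lemma downcross_salg (K : set (set T)) s l k : sigma_algebra setT K ->
  (forall t, t \in l -> 0 <= t /\ H t `<=` K) ->
  K [set w | (k <= downcross a b s [seq x t w | t <- l])%N].
Proof.
move=> KS; elim: l s k => [|t l IH] s k lK.
  case: k => [|k].
    by rewrite (_ : mkset _ = setT); [exact: salg_setT|by apply/seteqP; split].
  by rewrite (_ : mkset _ = set0); [exact: salg_set0|by apply/seteqP; split].
have [t0 tK] := lK t (mem_head _ _).
have {}IH s' k' := IH s' k' (fun u ul => lK u (mem_behead (s := t :: l) ul)).
case: s.
- rewrite (_ : mkset _ = ([set w | x t w < a] `&` N false l k.-1) `|`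
      (~` [set w | x t w < a] `&` N true l k)).
    apply: salg_setU => //; (apply: salg_setI => //; last exact: IH).
    + by apply: tK; exact: x_lt.
    + by apply: salg_setC => //; apply: tK; exact: x_lt.
  apply/seteqP; split => w; rewrite /N /=.
    by case: ifPn => xw h; [left; split => //; case: k h|right; split => //; exact/negP].
  by move=> [[-> h]|[/negP/negbTE -> //]]; case: k h.
- rewrite (_ : mkset _ = ([set w | b < x t w] `&` N true l k) `|`
      (~` [set w | b < x t w] `&` N false l k)).
    apply: salg_setU => //; (apply: salg_setI => //; last exact: IH).
    + by apply: tK; exact: x_gt.
    + by apply: salg_setC => //; apply: tK; exact: x_gt.
  apply/seteqP; split => w; rewrite /N /=.
    by case: ifPn => xw h; [left; split|right; split => //; exact/negP].
  by move=> [[-> h]|[/negP/negbTE -> //]].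
Qed.

Let mN s l k : (forall t, t \in l -> 0 <= t) -> measurable (N s l k).
Proof.
move=> l0; apply: downcross_salg; first exact: sigma_algebra_measurable.
by move=> t /l0 t0; split => //; exact: HM.
Qed.

Let rho := (1 - b) / (1 - a).

Let u0 : 0 < 1 - a. Proof. by rewrite subr_gt0 (lt_le_trans ab b1). Qed.

Let rho0 : 0 <= rho. Proof. by rewrite divr_ge0 ?subr_ge0// (le_trans (ltW ab)). Qed.

Let rho1 : rho < 1. Proof. by rewrite ltr_pdivrMr// mul1r ltrD2l ltrN2. Qed.

(* Conditionally on being above [b] (resp. below [a]) at a grid time, the complement
   of [C] has probability at most [1 - b] (resp. at least [1 - a]), hence each
   downcrossing costs a factor [rho]. *)
Lemma dubins_inequality l : forall h A k, 0 <= h -> path <=%R h l -> H h A ->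
  pr P (A `&` N false l k) <= rho ^+ k * pr P A /\
  (1 - a) * pr P (A `&` N true l k.+1) <= rho ^+ k * pr P (A `\` C).
Proof.
(* The two claims feed each other. A passage above [b] reduces the first claim at [k.+1] to the
   second at [k], gaining the factor [1 - b]; a passage below [a] reduces the second to the first
   with the same [k], paying [1 - a]. Hence [k.+1] crossings against the exponent [k] in the second
   claim. *)
elim: l => [|t l IH] h A k h0.
  move=> _ HA; rewrite [N true _ _](_ : _ = set0); last by apply/seteqP; split.
  rewrite setI0 pr0 mulr0; split; last by rewrite mulr_ge0 ?pr_ge0 ?exprn_ge0.
  case: k => [|k].
    by rewrite expr0 mul1r [N _ _ _](_ : _ = setT) ?setIT//; apply/seteqP; split.
  rewrite [N false _ _](_ : _ = set0); last by apply/seteqP; split.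
  by rewrite setI0 pr0 mulr_ge0 ?pr_ge0 ?exprn_ge0.
rewrite /= => /andP[ht tl] HA; have t0 := le_trans h0 ht.
have HtA : H t A by exact: Hle HA.
have mA := HM t0 HtA.
have l0 u : u \in l -> 0 <= u.
  move=> ul; apply: (le_trans t0).
  by have /allP := order_path_min le_trans tl; exact.
have tl0 u : u \in t :: l -> 0 <= u by rewrite inE => /predU1P[->//|/l0].
have St := HS t0.
have mD X : measurable X -> measurable (X `\` C) by move=> mX; exact: measurableD.
have prC X : measurable X -> pr P (X `\` C) = pr P X - pr P (X `&` C).
  by move=> mX; rewrite (pr_split P mX mC) addrC addKr.
split.
- case: k => [|k].
    rewrite expr0 mul1r; apply: pr_le => //.
    by apply: measurableI => //; exact: mN.
  have Hi := x_gt t0; set Hit := [set w | b < x t w] in Hi.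
  have HAi : H t (A `&` Hit) by exact: salg_setI.
  have HAd : H t (A `\` Hit) by exact: salg_setD.
  have [mAi mAd mHi] := And3 (HM t0 HAi) (HM t0 HAd) (HM t0 Hi).
  rewrite (pr_split P _ mHi); last by apply: measurableI => //; exact: mN.
  rewrite [X in pr P X + _](_ : _ = A `&` Hit `&` N true l k.+1); last first.
    apply/seteqP; split => w; rewrite /N /Hit /=.
      by move=> [[Aw +] xw]; rewrite xw.
    by move=> [[Aw xw] hw]; rewrite xw.
  rewrite [X in _ + pr P X](_ : _ = (A `\` Hit) `&` N false l k.+1); last first.
    apply/seteqP; split => w; rewrite /N /Hit /=.
      by move=> [[Aw +] xw]; rewrite (negbTE (introN idP xw)).
    by move=> [[Aw xw] hw]; rewrite (negbTE (introN idP xw)).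
  rewrite (pr_split P mA mHi) mulrDr lerD//; last by have [] := IH t _ k.+1 t0 tl HAd.
  have [_ h1] := IH t _ k t0 tl HAi.
  rewrite -(ler_pM2l u0); apply: (le_trans h1).
  rewrite exprSr /rho -/rho [rho ^+ k * _ * _]mulrAC !mulrA [(1 - a) * _]mulrC.
  rewrite -!mulrA ler_wpM2l ?exprn_ge0//.
  rewrite [X in _ <= X](_ : _ = (1 - b) * pr P (A `&` Hit)); last first.
    by field; rewrite lt0r_neq0.
  rewrite prC// mulrBl mul1r lerD2l lerN2.
  apply: (cprob_on_ge_pr St (HM t0) (salg_setT St) mC (xC t0)) => //.
  by move=> w [_ /= bx]; rewrite lee_fin ltW.
- have Lo := x_lt t0; set Lot := [set w | x t w < a] in Lo.
  have HAi : H t (A `&` Lot) by exact: salg_setI.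
  have HAd : H t (A `\` Lot) by exact: salg_setD.
  have [mAi mAd mLo] := And3 (HM t0 HAi) (HM t0 HAd) (HM t0 Lo).
  rewrite (pr_split P _ mLo); last by apply: measurableI => //; exact: mN.
  rewrite [X in pr P X + _](_ : _ = A `&` Lot `&` N false l k); last first.
    apply/seteqP; split => w; rewrite /N /Lot /=.
      by move=> [[Aw +] xw]; rewrite xw.
    by move=> [[Aw xw] hw]; rewrite xw.
  rewrite [X in _ + pr P X](_ : _ = (A `\` Lot) `&` N true l k.+1); last first.
    apply/seteqP; split => w; rewrite /N /Lot /=.
      by move=> [[Aw +] xw]; rewrite (negbTE (introN idP xw)).
    by move=> [[Aw xw] hw]; rewrite (negbTE (introN idP xw)).
  rewrite (pr_split P (mD _ mA) mLo) !mulrDr lerD//; last first.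
    have [_] := IH t _ k t0 tl HAd.
    by rewrite [X in _ <= _ * pr P X -> _](_ : _ = (A `\` C) `\` Lot)// !setDE setIAC.
  have [h1 _] := IH t _ k t0 tl HAi.
  apply: (le_trans (ler_wpM2l (ltW u0) h1)).
  rewrite mulrCA ler_wpM2l ?exprn_ge0//.
  rewrite [X in _ <= pr P X](_ : _ = (A `&` Lot) `\` C); last by rewrite !setDE setIAC.
  rewrite prC// mulrBl mul1r lerD2l lerN2.
  apply: (cprob_on_le_pr St (HM t0) (salg_setT St) mC (xC t0)) => //.
  by move=> w [_ /= bx]; rewrite lee_fin ltW.
Qed.

(** The bound [rho ^+ k] is the same for all grids, so it passes to their increasing union and then
    tends to 0 with [k]. *)
Lemma downcross_finite :
  P (\bigcap_k \bigcup_n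
     [set w | (k <= downcross a b false [seq x t w | t <- qgrid n])%N]) = 0%E.
Proof.
have mNn n k : measurable (N false (qgrid n) k) by apply: mN => t; exact: qgrid_ge0.
apply: pr_bigcap0; first by move=> k; apply: bigcup_measurable => n _; exact: mNn.
move=> e e0.
have [k ke] : exists k, rho ^+ k <= e.
  have /cvgrPdist_le/(_ _ e0) : rho ^+ n @[n --> \oo] --> (0 : R).
    by apply: cvg_expr; rewrite ger0_norm.
  move=> [k _ /(_ k (leqnn _))]; rewrite /= sub0r normrN ger0_norm ?exprn_ge0//.
  by exists k.
exists k; apply: (pr_bigcup_le (A := fun n => N false (qgrid n) k)) => //.
- move=> n m nm; apply/subsetPset => w; rewrite /N /= => /leq_trans; apply.
  by apply: downcross_subseq; apply: map_subseq; exact: qgrid_subseq.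
move=> n; apply: le_trans ke.
have p : path <=%R (0 : R) (qgrid n).
  rewrite path_min_sorted; last by apply/allP => t; exact: qgrid_ge0.
  exact: (sub_sorted (fun x y => @ltW _ _ x y) (qgrid_sorted n)).
have [] := dubins_inequality k (lexx 0) p (salg_setT (HS (lexx _))).
rewrite setTI => /le_trans + _; apply.
rewrite -[leRHS]mulr1 ler_wpM2l ?exprn_ge0// pr_le1//.
Qed.

End dubins.

(** * Right-continuous versions of conditional probabilities *)

Lemma bounded_convergence {R : realType} {d} {T : measurableType d} (P : probability T R)
    (A N : set T) (f_ : nat -> T -> R) (f : T -> R) (M : R) :
  measurable A -> measurable N -> P N = 0%E ->
  (forall n, measurable_fun A (f_ n)) -> measurable_fun A f ->
  (forall n w, `|f_ n w| <= M) ->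
  (forall w, ~ N w -> f_ n w @[n --> \oo] --> f w) ->
  (\int[P]_(w in A) (f_ n w)%:E @[n --> \oo] --> \int[P]_(w in A) (f w)%:E)%E.
Proof.
move=> mA mN N0 mf_ mf fM ff.
have [] // := @dominated_convergence _ _ _ P A mA (fun n w => (f_ n w)%:E) (EFin \o f) (cst M%:E).
- by move=> n; exact/measurable_EFinP.
- exact/measurable_EFinP.
- exists N; split => // w /= nw; apply: contrapT => /ff fw; apply: nw => _.
  by apply: cvg_EFin => //; near=> n.
- by apply: finite_measure_integrable_cst => //.
- by apply: aeW => w n _; rewrite lee_fin.
Unshelve. all: by end_near. Qed.

Section limits_without_downcrossings.
Context {R : realType}.

(** [N e] stands for the rational times within [e] of a point, on one side of it, so that left and
    right limits are treated together. The limit is the upper limit [sup E]; the lower bound comes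
    from two rational levels just under [sup E], where the alternative of staying below the upper
    one contradicts the supremum. *)
Lemma lim_no_downcross (N : R -> set R) (f : R -> R) :
  (forall e, 0 < e -> N e !=set0) -> (forall e e', e <= e' -> N e `<=` N e') ->
  (forall q, 0 <= f q <= 1) ->
  (forall i j, qenum i < qenum j :> R -> qenum j <= 1 :> R -> exists2 e, 0 < e &
    (forall q, N e q -> f q <= qenum j) \/ (forall q, N e q -> qenum i <= f q)) ->
  exists2 L, 0 <= L <= 1 & forall e, 0 < e ->
    exists2 r, 0 < r & forall q, N r q -> `|f q - L| <= e.
Proof.
move=> N0 Nle f01 fN.
pose E := [set c | forall e, 0 < e -> exists2 q, N e q & c <= f q].
have E0 : E 0 by move=> e /N0[q Nq]; exists q => //; case/andP: (f01 q).
have E1 c : E c -> c <= 1.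
  by move=> /(_ 1 ltr01)[q _ /le_trans]; apply; case/andP: (f01 q).
have supE : has_sup E by split; [exists 0|exists 1].
have L01 : 0 <= sup E <= 1.
  apply/andP; split; first by apply: ub_le_sup => //; exact: supE.2.
  by apply: ge_sup => //; exists 0.
exists (sup E) => // e e0.
have [r1 r10 fr1] : exists2 r, 0 < r & forall q, N r q -> f q <= sup E + e.
  have : ~ E (sup E + e).
    move=> /(ub_le_sup supE.2); apply/negP; rewrite -ltNge.
    by rewrite ltrDl.
  move=> /existsNP[r /not_implyP[r0 nr]]; exists r => // q Nq.
  by rewrite leNgt; apply/negP => fq; apply: nr; exists q => //; exact: ltW.
have [r2 r20 fr2] : exists2 r, 0 < r & forall q, N r q -> sup E - e <= f q.
  (* If [sup E <= e], the lower bound is just [0 <= f]; otherwise [sup E - e] is nonnegative and the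
     levels [qenum] are dense above it. *)
  have [Le|eL] := leP (sup E) e.
    exists 1 => // q _; apply: (@le_trans _ _ 0); first by rewrite subr_le0.
    by case/andP: (f01 q).
  have Le : sup E - e < sup E by rewrite ltrBlDr ltrDl.
  have Le0 : 0 <= sup E - e by rewrite subr_ge0 ltW.
  have [i /andP[Li iL]] := qenum_dense Le0 Le.
  have [j /andP[ij jL]] := qenum_dense (qenum_ge0 i) iL.
  have j1 : qenum j <= 1 :> R by rewrite (le_trans (ltW jL))//; case/andP: L01.
  have [r r0 [rj|ri]] := fN i j ij j1; last first.
    by exists r => // q /ri; apply: le_trans; exact: ltW.
  have [c Ec jc] := sup_gt supE.1 jL.
  have [q Nq cq] := Ec _ r0.
  by have := le_trans cq (rj _ Nq); rewrite leNgt jc.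
exists (Num.min r1 r2); first by rewrite lt_min r10.
move=> q Nq; rewrite ler_distl; apply/andP; split.
  by apply: fr2; apply: Nle Nq; rewrite ge_min lexx orbT.
by apply: fr1; apply: Nle Nq; rewrite ge_min lexx.
Qed.

Context (a b : R) (f : R -> R).

(** The list grows at its head: between [t] and its first point there is always room for one more
    descent. The default [t + 1] of [head] serves the empty list. *)
Lemma downcross_many_right (t : R) : 0 <= t ->
  (forall e, 0 < e -> exists n, t < qenum n < t + e /\ b < f (qenum n)) ->
  (forall e, 0 < e -> exists n, t < qenum n < t + e /\ f (qenum n) < a) ->
  forall k, exists l, [/\ sorted <%R l,
    (forall u, u \in l -> t < u /\ exists n, u = qenum n) &
    (k <= downcross a b false (map f l))%N].
Proof.
move=> t0 hb ha; elim=> [|k [l [sl lt kl]]]; first by exists [::].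
pose u := head (t + 1) l.
have tu : t < u.
  by rewrite /u; case: l lt {sl kl u} => [_|x l /(_ x (mem_head _ _))[]] //=; rewrite ltrDl.
have [i [/andP[ti iu] fi]] : exists n, t < qenum n < u /\ f (qenum n) < a.
  by have := ha (u - t); rewrite subr_gt0 addrC subrK => /(_ tu).
have [j [/andP[tj ji] fj]] : exists n, t < qenum n < (qenum i : R) /\ b < f (qenum n).
  by have := hb (qenum i - t); rewrite subr_gt0 addrC subrK => /(_ ti).
exists (qenum j :: qenum i :: l); split.
- by rewrite /= ji/=; case: l sl lt kl @u tu iu => //= x l -> _ _ _ ->.
- move=> v; rewrite !inE => /predU1P[->|/predU1P[->|/lt//]].
    by split => //; exists j.
  by split => //; exists i.
- by rewrite /= fj fi.
Qed.

(** Here the times accumulate at the end of the list, so the induction builds what follows an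
    arbitrary [s < t]. *)
Lemma downcross_many_left (t : R) : 0 < t ->
  (forall s, 0 <= s < t -> exists n, s < qenum n < t /\ b < f (qenum n)) ->
  (forall s, 0 <= s < t -> exists n, s < qenum n < t /\ f (qenum n) < a) ->
  forall k s, 0 <= s < t -> exists l, [/\ path <%R s l,
    (forall u, u \in l -> exists n, u = qenum n) &
    (k <= downcross a b false (map f l))%N].
Proof.
move=> t0 hb ha; elim=> [s _|k IH s st]; first by exists [::].
have [j [/andP[sj jt] fj]] := hb s st.
have [i [/andP[ji it] fi]] : exists n, (qenum j : R) < qenum n < t /\ f (qenum n) < a.
  by apply: ha; rewrite qenum_ge0.
have [|l [sl lq kl]] := IH (qenum i); first by rewrite qenum_ge0.
exists (qenum j :: qenum i :: l); split.
- by rewrite /= sj ji.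
- move=> v; rewrite !inE => /predU1P[->|/predU1P[->|/lq//]]; first by exists j.
  by exists i.
- by rewrite /= fj fi.
Qed.

End limits_without_downcrossings.

Section good_filtrations.
Context {R : realType} {d} {Omega : measurableType d} (Q : probability Omega R).
Context (F : R -> set (set Omega)) (gF : good_filtration Q F).

Lemma filt_salg (t : R) : 0 <= t -> sigma_algebra setT (F t).
Proof. by case: gF => + _ _ _ => /[apply] -[]. Qed.

Lemma filt_measurable (t : R) : 0 <= t -> F t `<=` measurable.
Proof. by case: gF => + _ _ _ => /[apply] -[]. Qed.

Lemma filt_le (s t : R) : 0 <= s -> s <= t -> F s `<=` F t.
Proof. by case: gF => _ + _ _; apply. Qed.

Lemma filt_right (t : R) A : 0 <= t -> (forall s, t < s -> F s A) -> F t A.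
Proof. by case: gF => _ _ + _ t0 h => ->. Qed.

Lemma filt_sinfty (t : R) : 0 <= t -> F t `<=` sinfty F.
Proof. by move=> t0 A FA; apply: sub_sigma_algebra; exists t. Qed.

Lemma sinfty_measurable : sinfty F `<=` measurable.
Proof.
apply: gsalg_sub; first exact: sigma_algebra_measurable.
by move=> A [t /= t0]; exact: filt_measurable.
Qed.

Lemma filt_null (t : R) A B : 0 <= t -> sinfty F A -> Q A = 0%E -> B `<=` A -> F t B.
Proof.
move=> t0 FA A0 BA; apply: (filt_le (lexx 0) t0); case: gF => _ _ _; apply.
by apply: sub_sigma_algebra; exists A; split => //; split => //; exact: sinfty_measurable.
Qed.

End good_filtrations.

Section rcll_paths.
Context {R : realType}.

Definition rcll (x : R -> R) :=
  (forall t, 0 <= t -> forall e, 0 < e ->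
    exists2 r, 0 < r & forall u, t < u < t + r -> `|x u - x t| <= e) /\
  (forall t, 0 < t -> exists L, forall e, 0 < e ->
    exists2 r, 0 < r & forall u, t - r < u < t -> `|x u - L| <= e).

Lemma rcll_cadlag {T : Type} (X : R -> T -> R) : (forall w, rcll (X^~ w)) -> cadlag X.
Proof.
move=> rX w t t0; have [rX1 rX2] := rX w; split.
  apply/cvgrPdist_le => e e0; have [r r0 rt] := rX1 t t0 e e0.
  near=> u; rewrite distrC; apply: rt; apply/andP; split; near: u.
    exact: nbhs_right_gt.
  by apply: nbhs_right_lt; rewrite ltrDl.
move=> {}t0; have [L rL] := rX2 t t0; apply/cvg_ex; exists L.
apply/cvgrPdist_le => e e0; have [r r0 rt] := rL e e0.
near=> u; rewrite distrC; apply: rt; apply/andP; split; near: u.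
  by apply: nbhs_left_gt; rewrite ltrBlDr ltrDl.
exact: nbhs_left_lt.
Unshelve. all: by end_near. Qed.

End rcll_paths.

Section regularization.
Context {R : realType} {d} {Omega : measurableType d} (Q : probability Omega R).
Context (F : R -> set (set Omega)) (gF : good_filtration Q F).

(** [X t] is the limit of arbitrary versions [x q] along rationals [q] decreasing to [t], and 0 on
    an exceptional null set. It is still a version at time [t]: all these [x q] have the same
    integral over an event of [F t], and the limit is [F t]-measurable by right-continuity of
    [F]. *)
Lemma rcll_cprob (C : set Omega) : measurable C ->
  exists X : R -> Omega -> R, [/\ forall t w, 0 <= X t w <= 1,
    forall w, rcll (X^~ w) &
    forall t, 0 <= t -> cprob_on Q (F t) setT C (EFin \o X t)].
Proof.
move=> mC.
have [x xP] : exists x : R -> Omega -> R, forall t, (forall w, 0 <= x t w <= 1) /\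
    (0 <= t -> cprob_on Q (F t) setT C (EFin \o x t)).
  suff /choice[x xP] : forall t : R, exists f : Omega -> R, (forall w, 0 <= f w <= 1) /\
      (0 <= t -> cprob_on Q (F t) setT C (EFin \o f)) by exists x.
  move=> t; have [t0|_] := boolP (0 <= t); last first.
    by exists (fun=> 0); split => // w; rewrite lexx ler01.
  have [f [f01 fC]] := cprob_exists Q (filt_salg gF t0) (filt_measurable gF t0) mC.
  by exists f.
have x01 t w : 0 <= x t w <= 1 by case: (xP t).
have xC (t : R) : 0 <= t -> cprob_on Q (F t) setT C (EFin \o x t) by case: (xP t).
pose bad i j := \bigcap_k \bigcup_n [set w | (k <= downcross (qenum i) (qenum j) false
  [seq x t w | t <- qgrid n])%N].
(* Levels up to 1 are those that the downcrossing bound admits, and they suffice since [x] takes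
   values in [[0, 1]]. *)
pose N := \bigcup_i \bigcup_(j in [set j | (qenum i < qenum j :> R) /\ (qenum j <= 1 :> R)])
  bad i j.
have sinftyS : sigma_algebra setT (sinfty F) by exact: gsalg.
have badF i j : sinfty F (bad i j).
  apply: salg_bigcap => // k; apply: salg_bigcup => // n.
  apply: (downcross_salg (filt_salg gF) xC) => // t tn.
  by have t0 := qgrid_ge0 tn; split => //; exact: filt_sinfty.
have NF : sinfty F N.
  by apply: salg_bigcup => // i; apply: salg_bigcup_in => // j _; exact: badF.
have mN := sinfty_measurable gF NF.
have N0 : Q N = 0%E.
  apply: measure_bigcup0 => i.
    by apply: (sinfty_measurable gF); apply: salg_bigcup_in => // j _; exact: badF.
  rewrite bigcup_mkcond; apply: measure_bigcup0 => j; case: ifPn => // /set_mem[ij j1].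
    by apply: (sinfty_measurable gF); exact: badF.
  apply: (downcross_finite (filt_salg gF) (filt_measurable gF) (filt_le gF) mC xC) => //.
  exact: qenum_ge0.
have FN (t : R) : 0 <= t -> F t N by move=> t0; apply: (filt_null gF t0 NF N0).
(* Every increasing list of rational times is a subsequence of some grid, so one bound serves all
   lists. *)
have fewcross w i j : ~ N w -> qenum i < qenum j :> R -> qenum j <= 1 :> R ->
    exists k, forall l, sorted <%R l -> (forall t, t \in l -> exists n, t = qenum n) ->
    (downcross (qenum i) (qenum j) false [seq x t w | t <- l] < k)%N.
  move=> nN ij j1; have : ~ bad i j w by move=> bw; apply: nN; exists i => //; exists j.
  move=> /existsNP[k /not_implyP[_ nk]]; exists k => l sl ql.
  have [n ln] := sorted_subseq_qgrid sl ql.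
  rewrite ltnNge; apply/negP => kl; apply: nk; exists n => //=.
  by apply: leq_trans kl _; apply: downcross_subseq; exact: map_subseq.
have rlim w (t : R) : ~ N w -> 0 <= t -> exists2 L, 0 <= L <= 1 & forall e, 0 < e ->
    exists2 r, 0 < r & forall n, t < qenum n < t + r -> `|x (qenum n) w - L| <= e.
  move=> nN t0.
  have [||||L L01 LP] := @lim_no_downcross _
    (fun e => [set q | t < q < t + e /\ exists n, q = qenum n]) (x^~ w).
  - move=> e e0; have [|n nt] := @qenum_dense _ t (t + e) t0; first by rewrite ltrDl.
    by exists (qenum n); split => //; exists n.
  - move=> e e' ee' q [/andP[tq qe] ?]; split => //; rewrite tq (lt_le_trans qe)//.
    by rewrite lerD2l.
  - by move=> q; exact: x01.
  - move=> i j ij j1; apply: contrapT => /forall2NP noe.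
    have [k klt] := fewcross w i j nN ij j1.
    have [||l [sl lq]] := @downcross_many_right _ (qenum i) (qenum j) (x^~ w) t t0 _ _ k.
    + move=> e e0; have [//|/not_orP[/existsNP[q /not_implyP[[qt [n qn]] /negP nx]] _]] := noe e.
      by move: nx; rewrite -ltNge => xq; exists n; rewrite -qn.
    + move=> e e0; have [//|/not_orP[_ /existsNP[q /not_implyP[[qt [n qn]] /negP nx]]]] := noe e.
      by move: nx; rewrite -ltNge => xq; exists n; rewrite -qn.
    by rewrite leqNgt klt// => u /lq[].
  exists L => // e e0; have [r r0 rL] := LP e e0; exists r => // n nt.
  by apply: rL; split => //; exists n.
have llim w (t : R) : ~ N w -> 0 < t -> exists L, forall e, 0 < e ->
    exists2 r, 0 < r & forall n, t - r < qenum n < t -> `|x (qenum n) w - L| <= e.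
  move=> nN t0.
  have [||||L L01 LP] := @lim_no_downcross _
    (fun e => [set q | t - e < q < t /\ exists n, q = qenum n]) (x^~ w).
  - move=> e e0.
    have [||n /andP[nt nt']] := @qenum_dense _ (Num.max 0 (t - e)) t.
    + by rewrite le_max lexx.
    + by rewrite gt_max t0 ltrBlDr ltrDl.
    exists (qenum n); split; last by exists n.
    by rewrite nt' andbT; move: nt; rewrite gt_max => /andP[].
  - move=> e e' ee' q [/andP[tq qe] ?]; split => //; rewrite qe (le_lt_trans _ tq)//.
    by rewrite lerD2l lerN2.
  - by move=> q; exact: x01.
  - move=> i j ij j1; apply: contrapT => /forall2NP noe.
    have [k klt] := fewcross w i j nN ij j1.
    have [|||l [sl lq]] := @downcross_many_left _ (qenum i) (qenum j) (x^~ w) t t0 _ _ k 0.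
    + move=> s /andP[s0 st].
      have [/negP|/not_orP[/existsNP[q /not_implyP[[qt [n qn]] /negP nx]] _]] := noe (t - s).
        by rewrite subr_gt0 st.
      move: nx; rewrite -ltNge => xq; exists n; rewrite -qn; split => //.
      by move: qt; rewrite opprB addrC subrK.
    + move=> s /andP[s0 st].
      have [/negP|/not_orP[_ /existsNP[q /not_implyP[[qt [n qn]] /negP nx]]]] := noe (t - s).
        by rewrite subr_gt0 st.
      move: nx; rewrite -ltNge => xq; exists n; rewrite -qn; split => //.
      by move: qt; rewrite opprB addrC subrK.
    + by rewrite lexx.
    by rewrite leqNgt klt//; exact: path_sorted sl.
  exists L => e e0; have [r r0 rL] := LP e e0; exists r => // n nt.
  by apply: rL; split => //; exists n.
have [X XP] : exists X : R -> Omega -> R, forall t w, 0 <= X t w <= 1 /\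
    (N w -> X t w = 0) /\ (~ N w -> 0 <= t -> forall e, 0 < e -> exists2 r, 0 < r &
      forall n, t < qenum n < t + r -> `|x (qenum n) w - X t w| <= e).
  have : forall tw : R * Omega, exists y, 0 <= y <= 1 /\ (N tw.2 -> y = 0) /\
      (~ N tw.2 -> 0 <= tw.1 -> forall e, 0 < e -> exists2 r, 0 < r &
       forall n, tw.1 < qenum n < tw.1 + r -> `|x (qenum n) tw.2 - y| <= e).
    move=> [t w] /=; have [Nw|nN] := pselect (N w).
      by exists 0; split; [rewrite lexx ler01|].
    have [t0|t0] := boolP (0 <= t); last by exists 0; split; [rewrite lexx ler01|].
    by have [L L01 LP] := rlim w t nN t0; exists L.
  by move=> /choice[Y YP]; exists (fun t w => Y (t, w)) => t w; exact: (YP (t, w)).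
have X01 t w : 0 <= X t w <= 1 by case: (XP t w).
exists X; split => //.
- move=> w; have [Nw|nN] := pselect (N w).
    have X0 t : X t w = 0 by case: (XP t w) => _ [/(_ Nw)].
    split.
      by move=> t t0 e e0; exists 1 => // u _; rewrite !X0 subrr normr0 ltW.
    by move=> t t0; exists 0 => e e0; exists 1 => // u _; rewrite !X0 subrr normr0 ltW.
  (* Every value of [X] near [t] is a limit of values of [x] near [t]. *)
  have near_X (u v L e : R) : 0 <= u -> u < v -> 0 < e ->
      (forall n, u < qenum n < v -> `|x (qenum n) w - L| <= e) -> `|X u w - L| <= e + e.
    move=> u0 uv e0 xL; have [_ [_ /(_ nN u0 e e0)[r r0 rX]]] := XP u w.
    have [|n /andP[un]] := @qenum_dense _ u (Num.min v (u + r)) u0.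
      by rewrite lt_min uv ltrDl.
    rewrite lt_min => /andP[nv nr].
    have -> : X u w - L = (x (qenum n) w - L) - (x (qenum n) w - X u w) by ring.
    apply: (le_trans (ler_normB _ _)); apply: lerD; first by apply: xL; rewrite un.
    by apply: rX; rewrite un.
  split.
  + move=> t t0 e e0; have e20 : 0 < e / 2 by rewrite divr_gt0.
    have [_ [_ /(_ nN t0 _ e20)[r r0 rX]]] := XP t w.
    exists r => // u /andP[tu ur]; rewrite [leRHS]splitr.
    apply: (near_X _ (t + r)) => //; first by rewrite (le_trans t0)// ltW.
    by move=> n /andP[un nr]; apply: rX; rewrite nr (lt_trans tu).
  + move=> t t0; have [L LP] := llim w t nN t0; exists L => e e0.
    have e20 : 0 < e / 2 by rewrite divr_gt0.
    have [r r0 rX] := LP _ e20.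
    exists (Num.min r t); first by rewrite lt_min r0.
    move=> u /andP[ru ut]; rewrite [leRHS]splitr.
    have ru' : t - r < u.
      by apply: le_lt_trans ru; rewrite lerD2l lerN2 ge_min lexx.
    apply: (near_X _ t) => //.
      have : t - t <= t - Num.min r t by rewrite lerD2l lerN2 ge_min lexx orbT.
      by rewrite subrr => /le_trans; apply; exact: ltW.
    by move=> n /andP[un nr]; apply: rX; rewrite nr (lt_trans ru').
move=> t t0.
have [q qP] : exists q : nat -> nat, forall n, t < qenum (q n) < t + n.+1%:R^-1.
  suff /choice[q qP] : forall n : nat, exists m, t < qenum m < t + n.+1%:R^-1 by exists q.
  by move=> n; apply: qenum_dense => //; rewrite ltrDl invr_gt0.
have cvgX w : ~ N w -> x (qenum (q n)) w @[n --> \oo] --> X t w.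
  move=> nN; apply/cvgrPdist_le => e e0.
  have [_ [_ /(_ nN t0 e e0)[r r0 rX]]] := XP t w.
  near=> n; rewrite distrC; apply: rX.
  have /andP[-> qn] /= := qP n; apply: (lt_trans qn); rewrite ltrD2l.
  near: n; have [m mr] := ltr_add_invr r0; exists m => // k /= mk.
  apply: le_lt_trans mr; rewrite add0r lef_pV2 ?posrE//.
  by rewrite ler_nat.
have mX : @measurable_fun _ _ (g_sigma_algebraType (F t)) _ setT (X t).
  move=> _ B mB; rewrite setTI; apply/measurable_gsalgE; first exact: (filt_salg gF).
  apply: (filt_right gF t0) => s ts; have s0 := le_trans t0 (ltW ts).
  have Fs := filt_salg gF s0.
  (* Dropping the first [m] terms of the sequence leaves only times before [s], so that the limit is
     measurable for [F s]. *)
  have [m ms] : exists m, t + m.+1%:R^-1 < s.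
    have st0 : 0 < s - t by rewrite subr_gt0.
    by have [m ms] := ltr_add_invr st0; exists m; rewrite addrC -ltrBrDr -[ltLHS]add0r.
  have mXs : @measurable_fun _ _ (g_sigma_algebraType (F s)) _ setT (X t).
    apply: (@measurable_fun_cvg _ (g_sigma_algebraType (F s)) R setT
      (fun n w => x (qenum (q (n + m)%N)) w * \1_(~` N) w)).
      move=> n; apply: measurable_funM.
        have q0 := qenum_ge0 (q (n + m)%N) : 0 <= qenum (q (n + m)%N) :> R.
        have [mx _ _] := xC _ q0.
        apply: (@measurable_fun_gsalgS _ _ _ (F (qenum (q (n + m)%N)))) => //.
        + exact: (filt_salg gF).
        + by apply: salg_setT; exact: (filt_salg gF).
        + apply: (filt_le gF q0); apply/ltW/(lt_trans _ ms).
          have /andP[_ /lt_le_trans] := qP (n + m)%N; apply.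
          by rewrite lerD2l lef_pV2 ?posrE// ler_nat ltnS leq_addl.
        + exact/measurable_EFinP.
      apply: measurable_indic; apply/measurable_gsalgE => //.
      by apply: salg_setC => //; exact: FN.
    move=> w _; have [Nw|nN] := pselect (N w).
      have [_ [-> //_]] := XP t w.
      apply: (@cvg_near_cst); near=> n.
      by rewrite indicE memNset ?mulr0//; apply.
    have -> : (fun n => x (qenum (q (n + m)%N)) w * \1_(~` N) w) =
              (fun n => x (qenum (q (n + m)%N)) w).
      by apply/funext => n; rewrite indicE mem_set// mulr1.
    by have := cvgX w nN; rewrite -(cvg_shiftn m).
  by rewrite -[X t @^-1` B]setTI; apply/measurable_gsalgE => //; exact: mXs.
split.
- exact/measurable_EFinP.
- by move=> w _; rewrite lee_fin; case/andP: (X01 t w).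
move=> A FA _; have mA := filt_measurable gF t0 FA.
have Ft := filt_salg gF t0.
have bc := @bounded_convergence _ _ _ Q A N (fun n => x (qenum (q n))) (X t) 1 mA mN N0.
have mxA s : 0 <= s -> measurable_fun A (x s).
  move=> s0; apply/measurable_EFinP; apply: measurable_funS (measurableT) _ _ => //.
  have [mx _ _] := xC s s0.
  by apply: (measurable_fun_gsalg (filt_salg gF s0) _ (filt_measurable gF s0) mx);
    apply: salg_setT; exact: (filt_salg gF).
have mXA : measurable_fun A (X t).
  apply: measurable_funS (measurableT) _ _ => //.
  by apply: (measurable_fun_gsalg Ft _ (filt_measurable gF t0) mX); exact: salg_setT.
have {bc} := bc (fun n => mxA _ (qenum_ge0 _)) mXA.
have -> : (fun n => \int[Q]_(w in A) (x (qenum (q n)) w)%:E)%E = (fun=> Q (A `&` C)).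
  apply/funext => n; have q0 := qenum_ge0 (q n) : 0 <= qenum (q n) :> R.
  have [_ _ -> //] := xC _ q0.
  by apply: (filt_le gF t0) FA; case/andP: (qP n) => /ltW.
have bd n w : `|x (qenum (q n)) w| <= 1.
  by case/andP: (x01 (qenum (q n)) w) => ? ?; rewrite ger0_norm.
move=> /(_ bd cvgX) h.
by rewrite -(cvg_lim _ h)// lim_cst.
Unshelve. all: by end_near. Qed.

End regularization.

(** * Optionality and stopping *)

(** Lets a sigma-algebra on [D] be handled as one on the whole type, with plain complements. *)
Lemma trace_salg {T : Type} (D : set T) (H : set (set T)) :
  sigma_algebra D H -> sigma_algebra setT [set A | H (D `&` A)].
Proof.
move=> [H0 HC HU]; split => /=.
- by rewrite setI0.
- move=> A HA; rewrite (_ : D `&` _ = D `\` (D `&` A)); first exact: HC.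
  by rewrite setTD setDIr setDv set0U setDE.
- by move=> A HA; rewrite setI_bigcupr; exact: HU.
Qed.

Section debut.
Context {R : realType} {d} {Omega : measurableType d} (Q : probability Omega R).
Context (F : R -> set (set Omega)) (gF : good_filtration Q F).

Lemma strict_stopping_time (S : Omega -> \bar R) : (forall w, (0 <= S w)%E) ->
  (forall t : R, 0 <= t -> F t [set w | (S w < t%:E)%E]) -> stopping_time F S.
Proof.
move=> S0 FS; split => // t t0; apply: (filt_right gF t0) => s ts.
have s0 := le_trans t0 (ltW ts).
(* The offset [m] puts all the times [t + 1/(n+m+1)] before [s], so every event of the intersection
   lies in [F s]. *)
have [m ms] : exists m, t + m.+1%:R^-1 < s.
  have st0 : 0 < s - t by rewrite subr_gt0.
  by have [m ms] := ltr_add_invr st0; exists m; rewrite addrC -ltrBrDr -[ltLHS]add0r.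
have -> : [set w | (S w <= t%:E)%E] =
    \bigcap_n [set w | (S w < (t + (n + m).+1%:R^-1)%:E)%E].
  apply/seteqP; split => w /=.
    by move=> St n _ /=; apply: le_lt_trans St _; rewrite lte_fin ltrDl invr_gt0.
  move=> St; apply/lee_addgt0Pr => e e0.
  have [k ke] := ltr_add_invr e0; apply/ltW/(lt_le_trans (St k I)).
  rewrite -EFinD lee_fin lerD2l (le_trans _ (ltW ke))// add0r lef_pV2 ?posrE//.
  by rewrite ler_nat ltnS leq_addr.
apply: salg_bigcap; first exact: (filt_salg gF).
move=> n; have tn0 : 0 <= t + (n + m).+1%:R^-1 by rewrite addr_ge0.
apply: (filt_le gF tn0); last exact: FS.
by apply/ltW/(le_lt_trans _ ms); rewrite lerD2l lef_pV2 ?posrE// ler_nat ltnS leq_addl.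
Qed.

Definition debut_after (S : Omega -> \bar R) (E : R -> set Omega) (w : Omega) : \bar R :=
  ereal_inf [set t%:E | t in [set t | [/\ 0 <= t, (S w < t%:E)%E & E t w]]].

Lemma debut_after_ge0 S E w : (0 <= debut_after S E w)%E.
Proof. by apply: le_ereal_inf_tmp => _ [t [t0 _ _] <-]; rewrite lee_fin. Qed.

(** Both [S < t] and [E t] persist for a short time to the right, so the infimum is below [t]
    exactly when some rational time before [t] qualifies. *)
Lemma debut_after_lt (S : Omega -> \bar R) (E : R -> set Omega) :
  (forall t : R, 0 <= t -> F t [set w | (S w < t%:E)%E]) ->
  (forall t : R, 0 <= t -> F t (E t)) ->
  (forall w t, 0 <= t -> E t w -> exists2 r, 0 < r & forall u, t < u < t + r -> E u w) ->
  forall t : R, 0 <= t -> F t [set w | (debut_after S E w < t%:E)%E].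
Proof.
move=> FS FE Eopen t t0.
have -> : [set w | (debut_after S E w < t%:E)%E] = \bigcup_(n in [set n | qenum n < t])
    ([set w | (S w < (qenum n)%:E)%E] `&` E (qenum n)).
  apply/seteqP; split => w /=.
    move=> /ereal_inf_lt[_ [u [u0 Su Eu] <-]]; rewrite lte_fin => ut.
    have [r r0 rE] := Eopen w u u0 Eu.
    have [|n /andP[un]] := @qenum_dense _ u (Num.min t (u + r)) u0.
      by rewrite lt_min ut ltrDl.
    rewrite lt_min => /andP[nt nr]; exists n => //; split => /=.
      by apply: lt_trans Su _; rewrite lte_fin.
    by apply: rE; rewrite un.
  move=> [n /= nt [Sn En]]; apply: (@le_lt_trans _ _ (qenum n)%:E); last by rewrite lte_fin.
  by apply: ereal_inf_lbound; exists (qenum n) => //; split => //; exact: qenum_ge0.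
apply: salg_bigcup_in; first exact: (filt_salg gF).
move=> n /= nt; apply: (filt_le gF (qenum_ge0 n) (ltW nt)).
by apply: salg_setI; [exact/(filt_salg gF)/qenum_ge0|exact/FS/qenum_ge0|exact/FE/qenum_ge0].
Qed.

End debut.

Section rcll_is_optional.
Context {R : realType} {d} {Omega : measurableType d} (Q : probability Omega R).
Context (F : R -> set (set Omega)) (gF : good_filtration Q F).
Context (X : R -> Omega -> R) (rX : forall w, rcll (X^~ w)).
Hypothesis Xgt : forall t b : R, 0 <= t -> F t [set w | b < X t w].
Hypothesis Xlt : forall t a : R, 0 <= t -> F t [set w | X t w < a].

Let right w (t : R) : 0 <= t -> forall e : R, 0 < e ->
    exists2 r, 0 < r & forall u, t < u < t + r -> `|X u w - X t w| <= e.
Proof. by have [+ _] := rX w; apply. Qed.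

Let right_gt w (t b : R) : 0 <= t -> b < X t w ->
  exists2 r, 0 < r & forall u, t < u < t + r -> b < X u w.
Proof.
move=> t0 bX; have e0 : 0 < (X t w - b) / 2 by rewrite divr_gt0// subr_gt0.
have [r r0 rt] := right w t0 e0; exists r => // u /rt.
rewrite ler_distl => /andP[+ _]; apply: lt_le_trans.
by rewrite ltrBrDr -ltrBrDl ltr_pdivrMr// ltr_pMr ?subr_gt0// ltr1n.
Qed.

Let right_lt w (t a : R) : 0 <= t -> X t w < a ->
  exists2 r, 0 < r & forall u, t < u < t + r -> X u w < a.
Proof.
move=> t0 Xa; have e0 : 0 < (a - X t w) / 2 by rewrite divr_gt0// subr_gt0.
have [r r0 rt] := right w t0 e0; exists r => // u /rt.
rewrite ler_distl => /andP[_]; move/le_lt_trans; apply.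
by rewrite -ltrBrDl ltr_pdivrMr// ltr_pMr ?subr_gt0// ltr1n.
Qed.

Section levels.
Context (a b : R) (ab : a < b).

Let sg n : Omega -> \bar R := debut_after (fun=> (qenum n)%:E) (fun t => [set w | b < X t w]).
Let rh n : Omega -> \bar R := debut_after (sg n) (fun t => [set w | X t w < a]).

Let sg_lt n (t : R) : 0 <= t -> F t [set w | (sg n w < t%:E)%E].
Proof.
apply: (debut_after_lt gF) => [{}t t0|{}t t0|w {}t].
- have [nt|nt] := boolP ((qenum n)%:E < t%:E)%E.
    rewrite (_ : mkset _ = setT); first exact: (salg_setT (filt_salg gF t0)).
    by apply/seteqP; split.
  rewrite (_ : mkset _ = set0); first exact: (salg_set0 (filt_salg gF t0)).
  by apply/seteqP; split => // w /=; rewrite (negbTE nt).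
- exact: Xgt.
- exact: right_gt.
Qed.

Let rh_lt n (t : R) : 0 <= t -> F t [set w | (rh n w < t%:E)%E].
Proof.
apply: (debut_after_lt gF) => [{}t t0|{}t t0|w {}t].
- exact: sg_lt.
- exact: Xlt.
- exact: right_lt.
Qed.

Let sg_stop n : stopping_time F (sg n).
Proof. by apply: (strict_stopping_time gF) => [w|t]; [exact: debut_after_ge0|exact: sg_lt]. Qed.

Let rh_stop n : stopping_time F (rh n).
Proof. by apply: (strict_stopping_time gF) => [w|t]; [exact: debut_after_ge0|exact: rh_lt]. Qed.

Let L : set (R * Omega) :=
  \bigcup_n [set p | 0 <= p.1 /\ (sg n p.2 <= p.1%:E)%E /\ (p.1%:E < rh n p.2)%E].

(** [sg n] is the first passage above [b] after the rational time [qenum n], and [rh n] the next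
    passage below [a]. By right-continuity [X] cannot be below [a] on [[sg n, rh n)], and the union
    [L] of these intervals separates. *)
Lemma between_levels_optional :
  exists E, [/\ optional F (Dpos `&` E), (forall p, Dpos p -> E p -> a <= X p.1 p.2) &
    (forall p, Dpos p -> b < X p.1 p.2 -> E p)].
Proof.
exists L; split.
- have oS := trace_salg (smallest_sigma_algebra Dpos
     [set [set p | 0 <= p.1 /\ (S p.2 <= p.1%:E)%E] | S in stopping_time F]).
  have gen S : stopping_time F S -> optional F (Dpos `&` [set p | (S p.2 <= p.1%:E)%E]).
    by move=> FS; apply: sub_sigma_algebra; exists S.
  suff : [set A | optional F (Dpos `&` A)] L by [].
  apply: (salg_bigcup oS) => n.
  have := salg_setD oS (gen _ (sg_stop n)) (gen _ (rh_stop n)).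
  rewrite /mkset; congr (optional F _); apply/seteqP; split => -[t w] /=.
    by move=> [t0 [sgt /negP]]; rewrite -ltNge => rht.
  by move=> [t0 [_ [sgt]]]; rewrite ltNge => /negP.
- move=> [t w] /= t0 [n _ /= [_ [sgt trh]]]; rewrite leNgt; apply/negP => Xa.
  have [sgt'|tsg] := ltP (sg n w) t%:E.
    move: trh; apply/negP; rewrite -leNgt; apply: ereal_inf_lbound.
    by exists t.
  have [r r0 rt] := right_lt t0 (lt_trans Xa ab).
  have : (sg n w < (t + r)%:E)%E by apply: le_lt_trans sgt _; rewrite lte_fin ltrDl.
  move=> /ereal_inf_lt[_ [u [u0 qu bu] <-]]; rewrite lte_fin => utr.
  have tu : t <= u.
    by rewrite -lee_fin (le_trans tsg)//; apply: ereal_inf_lbound; exists u.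
  move: bu; apply/negP; rewrite /= -leNgt; move: tu; rewrite le_eqVlt => /predU1P[<-|tu].
    by rewrite ltW// (lt_trans Xa ab).
  by apply/ltW/rt; rewrite tu.
- move=> [t w]; rewrite /Dpos /= => t0 bX.
  (* Whatever the left limit at [t], some rational [q] before [t] is such that
     [X] does not leave [[a, +oo[] between its first passage above [b] after [q]
     and [t]. *)
  suff [n [sgt aX]] : exists n, (sg n w <= t%:E)%E /\
      forall u, (sg n w < u%:E)%E -> u < t -> a <= X u w.
    exists n => //=; split => //; split => //.
    have [r r0 rt] := right_gt t0 (lt_trans ab bX).
    apply: (@lt_le_trans _ _ (t + r)%:E); first by rewrite lte_fin ltrDl.
    apply: le_ereal_inf_tmp => _ [u [u0 sgu Xu] <-]; rewrite lee_fin leNgt; apply/negP => utr.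
    move: Xu; apply/negP; rewrite -leNgt.
    have [tu|ut] := ltP t u; first by apply/ltW/rt; rewrite tu.
    move: ut; rewrite le_eqVlt => /predU1P[->|ut]; first by rewrite ltW// (lt_trans ab bX).
    exact: aX.
  (* At time 0 there is no left limit to consider; the index of the rational 0 makes the passage
     immediate. *)
  move: t0; rewrite le_eqVlt => /predU1P[t0|t0].
    exists (pickle (0 : rat)); split; last first.
      move=> u su; rewrite -t0 => u0; have := debut_after_ge0 _ _ w : (0 <= sg _ w)%E.
      by move=> /(_ (pickle (0 : rat)))/le_lt_trans/(_ su); rewrite lte_fin ltNge (ltW u0).
    apply/lee_addgt0Pr => e e0.
    have [r r0 rt] := right_gt (lexx _ : 0 <= 0 :> R) (eq_ind_r (fun s => b < X s w) bX t0).
    pose u := Num.min e (r / 2).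
    have u0 : 0 < u by rewrite lt_min e0 divr_gt0.
    have ur : u < r.
      apply: (@le_lt_trans _ _ (r / 2)); rewrite ?ge_min ?lexx ?orbT//.
      by rewrite ltr_pdivrMr// ltr_pMr// ltr1n.
    apply: (@le_trans _ _ u%:E).
      apply: ereal_inf_lbound; exists u => //; split => //; first exact: ltW.
        by rewrite /qenum pickleK rmorph0 normr0 lte_fin.
      by apply: rt; rewrite u0 add0r.
    by rewrite -t0 -EFinD lee_fin add0r ge_min lexx.
  have [_ /(_ t t0)[l lP]] := rX w.
  have sg_le n : qenum n < t -> (sg n w <= t%:E)%E.
    by move=> nt; apply: ereal_inf_lbound; exists t => //; split; rewrite ?lte_fin// ltW.
  (* If the left limit [l] is below [b], a rational close enough to [t] leaves no value above [b]
     before [t], and the second requirement is vacuous. If [l >= b], a close rational keeps [X]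
     above [a] all the way to [t]. *)
  have [lb|bl] := ltP l b.
    have e0 : 0 < (b - l) / 2 by rewrite divr_gt0// subr_gt0.
    have [r r0 rt] := lP _ e0.
    have [||n /andP[]] := @qenum_dense _ (Num.max 0 (t - r)) t.
    + by rewrite le_max lexx.
    + by rewrite gt_max t0 ltrBlDr ltrDl.
    rewrite gt_max => /andP[n0 nr] nt; exists n; split; first exact: sg_le.
    move=> u + ut => /ereal_inf_lt[_ [v [v0 qv bv] <-]]; rewrite lte_fin => vu.
    move: bv; rewrite /= => bv; exfalso.
    have := rt v; rewrite (lt_trans vu ut) andbT => /(_ _)/wrap[].
      by apply: (lt_trans nr); rewrite -lte_fin.
    rewrite ler_distl => /andP[_ h]; move: bv; apply/negP; rewrite -leNgt.
    apply: (le_trans h); rewrite -lerBrDl ler_pdivrMr// ler_peMr ?ler1n// subr_ge0.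
    exact: ltW.
  have e0 : 0 < (l - a) / 2 by rewrite divr_gt0// subr_gt0 (lt_le_trans ab).
  have [r r0 rt] := lP _ e0.
  have [||n /andP[]] := @qenum_dense _ (Num.max 0 (t - r)) t.
  + by rewrite le_max lexx.
  + by rewrite gt_max t0 ltrBlDr ltrDl.
  rewrite gt_max => /andP[n0 nr] nt; exists n; split; first exact: sg_le.
  move=> u su ut; have nu : qenum n < u.
    rewrite -lte_fin; apply: le_lt_trans su.
    by apply: le_ereal_inf_tmp => _ [v [_ qv _] <-]; exact: ltW.
  have := rt u; rewrite ut (lt_trans nr nu) => /(_ isT).
  rewrite ler_distl => /andP[h _]; apply: le_trans h.
  rewrite lerBrDr -lerBrDl ler_pdivrMr// ler_peMr ?ler1n// subr_ge0.
  exact: (le_trans (ltW ab)).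
Qed.

End levels.

Lemma rcll_optional (c : R) : optional F [set p | 0 <= p.1 /\ c <= X p.1 p.2].
Proof.
(* Both levels increase to [c] from below, so the intersection of the separating sets is exactly
   [{X >= c}]. *)
have ab n : c - 2 / n.+1%:R < c - 1 / n.+1%:R :> R.
  by rewrite ltrD2l ltrN2 ltr_pM2r ?invr_gt0// ltr1n.
have /choice[E EP] n := between_levels_optional (ab n).
have oS := trace_salg (smallest_sigma_algebra Dpos
     [set [set p | 0 <= p.1 /\ (S p.2 <= p.1%:E)%E] | S in stopping_time F]).
have : optional F (Dpos `&` \bigcap_n E n).
  by apply: (salg_bigcap oS) => n; case: (EP n).
congr (optional F _); apply/seteqP; split => -[t w] /= [t0 h]; split => //.
  apply/ler_addgt0Pr => e e0.
  have [k ke] := ltr_add_invr (divr_gt0 e0 (ltr0n R 2) : 0 < e / 2).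
  have [_ /(_ (t, w) t0 (h k I)) /= + _] := EP k.
  rewrite lerBlDr => /le_trans; apply; rewrite lerD2l mulrC -ler_pdivlMr//.
  by apply/ltW; rewrite -[ltLHS]add0r.
move=> n _; have [_ _] := EP n; apply => //=.
by apply: lt_le_trans h; rewrite ltrBlDr ltrDl divr_gt0.
Qed.

End rcll_is_optional.

(** * Value at [T] of the conditional probability of an event [B] before [T] *)

Section terminal_value.
Context {R : realType} {d} {Omega : measurableType d} (Q : probability Omega R).
Context (F : R -> set (set Omega)) (gF : good_filtration Q F).
Context (T : Omega -> \bar R) (FT : stopping_time F T).
Context (s : R) (s0 : 0 <= s) (B : set Omega) (FB : F s B).
Let C := B `&` [set w | (s%:E < T w)%E].
Context (X : R -> Omega -> R) (rX : forall w, rcll (X^~ w)).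
Context (X01 : forall t w, 0 <= X t w <= 1).
Context (XC : forall t : R, 0 <= t -> cprob_on Q (F t) setT C (EFin \o X t)).

Lemma stopping_time_gt (t : R) : 0 <= t -> F t [set w | (t%:E < T w)%E].
Proof.
move=> t0; have := salg_setC (filt_salg gF t0) (FT.2 t t0); congr (F t _).
by apply/seteqP; split => w /=; [move=> /negP; rewrite -ltNge|rewrite ltNge => /negP].
Qed.

Let FC (t : R) : s <= t -> F t C.
Proof.
move=> st; apply: (filt_le gF s0 st).
by apply: salg_setI; [exact: (filt_salg gF)|exact: FB|exact: stopping_time_gt].
Qed.

(** Let [q] be a rational after the stopped time. If [q >= s], then [C] is known at [q]; if [q < s],
    then [T <= q], which excludes [C] and is also known at [q]. In both cases [X q] is [\1_C] almost
    surely, and right-continuity carries this down to the stopped time. *)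
Lemma cprob_stopped_at_end : exists N, [/\ sinfty F N, Q N = 0%E &
  forall w, ~ N w -> forall t, s <= t -> X (fine (Order.min (T w) t%:E)) w = \1_C w].
Proof.
(* [Z n] and [O n] are events of [F (qenum n)] on which [C] certainly fails, respectively holds, so
   that [X] must be 0, respectively 1. *)
pose Z n := if s <= qenum n then ~` C else [set w | (T w <= (qenum n)%:E)%E].
pose O n := if s <= qenum n then C else set0.
have FZ n : F (qenum n) (Z n).
  have q0 := qenum_ge0 n : 0 <= qenum n :> R.
  rewrite /Z; case: ifPn => sq; last exact: FT.2.
  by apply: salg_setC; [exact: (filt_salg gF)|exact: FC].
have FO n : F (qenum n) (O n).
  have q0 := qenum_ge0 n : 0 <= qenum n :> R.
  rewrite /O; case: ifPn => sq; first exact: FC.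
  by apply: salg_set0; exact: (filt_salg gF).
have ZC n : Z n `&` C = set0.
  rewrite /Z; case: ifPn => sq; first by rewrite setIC setICr.
  apply/seteqP; split => // w [/= Tq [_ /= sT]].
  move: sq; rewrite -ltNge -lte_fin => /(le_lt_trans Tq)/(lt_trans sT).
  by rewrite ltxx.
have OC n : O n `<=` C by rewrite /O; case: ifPn => // _ w [].
have mC : measurable C by exact: (filt_measurable gF s0 (FC (lexx s))).
pose N n := (Z n `&` [set w | (0 < (X (qenum n) w)%:E)%E]) `|`
            (O n `&` [set w | ((X (qenum n) w)%:E < 1%:E)%E]).
have FN n : F (qenum n) (N n).
  have q0 := qenum_ge0 n : 0 <= qenum n :> R; have Fq := filt_salg gF q0.
  have FqT := salg_setT Fq.
  apply: salg_setU => //; apply: salg_setI => //.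
    by have := cprob_on_gt Fq FqT 0 (XC q0); rewrite setTI.
  have := salg_setC Fq (cprob_on_ge Fq FqT 1 (XC q0)); rewrite setTI; congr (F _ _).
  by apply/seteqP; split => w /=; [move=> /negP; rewrite -ltNge|rewrite ltNge => /negP].
have N0 n : Q (N n) = 0%E.
  have q0 := qenum_ge0 n : 0 <= qenum n :> R; have Fq := filt_salg gF q0.
  have FqT := salg_setT Fq; have Mq := filt_measurable gF q0.
  have h1 : Q (Z n `&` [set w | (0 < (X (qenum n) w)%:E)%E]) = 0%E.
    apply: (cprob_on_gt0 Fq Mq FqT mC (XC q0)) => // A FA AZ.
    rewrite (_ : A `&` C = set0) ?pr0 ?mul0r//.
    by rewrite -subset0 -(ZC n); exact: setSI.
  have h2 : Q (O n `&` [set w | ((X (qenum n) w)%:E < 1%:E)%E]) = 0%E.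
    apply: (cprob_on_lt0 Fq Mq FqT mC (XC q0)) => // A FA AO.
    by rewrite mul1r (setIidl (subset_trans AO (@OC n))).
  have m1 : measurable (Z n `&` [set w | (0 < (X (qenum n) w)%:E)%E]).
    apply: Mq; apply: salg_setI => //.
    by have := cprob_on_gt Fq FqT 0 (XC q0); rewrite setTI.
  have m2 : measurable (O n `&` [set w | ((X (qenum n) w)%:E < 1%:E)%E]).
    have := salg_setC Fq (cprob_on_ge Fq FqT 1 (XC q0)); rewrite setTI => h.
    apply: Mq; apply: salg_setI => //; move: h; congr (F _ _).
    by apply/seteqP; split => w /=; [move=> /negP; rewrite -ltNge|rewrite ltNge => /negP].
  by rewrite null_set_setU.
exists (\bigcup_n N n); split.
- by apply: salg_bigcup; [exact: gsalg|move=> n; exact: (filt_sinfty (qenum_ge0 n) (FN n))].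
- by apply: measure_bigcup0 => // n; exact: (filt_measurable gF (qenum_ge0 n) (FN n)).
move=> w nN t st; set v := fine _.
have T0 := FT.1 w.
have vE : v%:E = Order.min (T w) t%:E.
  by rewrite /v fineK//; case: (T w) T0 => [r||] //=; rewrite -?EFin_min// minye.
have v0 : 0 <= v by rewrite -lee_fin vE le_min T0 lee_fin (le_trans s0).
suff lim_const c : (exists2 r, 0 < r & forall n, v < qenum n < v + r -> X (qenum n) w = c) ->
    X v w = c.
  have [Cw|nC] := pselect (C w).
    rewrite indicE mem_set//; apply: lim_const; exists 1 => // n /andP[vn _].
    apply/eqP; rewrite eq_le; apply/andP; split; first by case/andP: (X01 (qenum n) w).
    rewrite leNgt; apply/negP => X1; apply: nN; exists n => //; right; split => //.
    suff sn : s <= qenum n by rewrite /O sn.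
    apply/ltW/(le_lt_trans _ vn); rewrite -lee_fin vE le_min lee_fin st andbT.
    by case: Cw => _ /= /ltW.
  rewrite indicE memNset//; apply: lim_const; exists 1 => // n /andP[vn _].
  apply/eqP; rewrite eq_le; apply/andP; split; last by case/andP: (X01 (qenum n) w).
  rewrite leNgt; apply/negP => X1; apply: nN; exists n => //; left; split => //.
  rewrite /Z; case: ifPn => //; rewrite -ltNge => ns /=.
  have : (Order.min (T w) t%:E < (qenum n)%:E)%E by rewrite -vE lte_fin.
  by rewrite gt_min => /orP[/ltW//|]; rewrite lte_fin ltNge (le_trans (ltW ns)).
move=> [r r0 rc]; apply/eqP; rewrite -subr_eq0 -normr_le0; apply/ler_addgt0Pr => e e0.
have [r' r'0 r'X] := (rX w).1 v v0 e e0.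
have [|n /andP[vn]] := @qenum_dense _ v (Num.min (v + r) (v + r')) v0.
  by rewrite lt_min !ltrDl r0.
rewrite lt_min => /andP[nr nr']; rewrite add0r distrC -(rc n) ?vn//.
by apply: r'X; rewrite vn.
Qed.

End terminal_value.

(** * The enlarged filtration *)

Section enlarged_filtration.
Context {R : realType} {d} {Omega : measurableType d} (Q : probability Omega R).
Context (F : R -> set (set Omega)) (tau : Omega -> \bar R).
Implicit Types (A B N : set Omega) (H : set (set Omega)).

Definition terminal : set (set Omega) := sjoin (sigma_rv tau) (sinfty F).

(** Stronger than [Qnull], whose covering set is merely measurable: with a covering set in
    [terminal], [B] belongs to [Nsig] and hence to every G_t. *)
Definition negl B := exists A, [/\ terminal A, Q A = 0%E & B `<=` A].

Definition aeq A B := exists2 N, negl N & forall w, ~ N w -> (A w <-> B w).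

Lemma sigma_rv_terminal : sigma_rv tau `<=` terminal.
Proof. by move=> A tA; apply: sub_sigma_algebra; left. Qed.

Lemma sinfty_terminal : sinfty F `<=` terminal.
Proof. by move=> A tA; apply: sub_sigma_algebra; right. Qed.

Lemma negl_sub A B : negl B -> A `<=` B -> negl A.
Proof. by move=> [C [KC C0 BC]] AB; exists C; split => //; exact: subset_trans BC. Qed.

Lemma negl_set0 : negl set0.
Proof. by exists set0; split => //; exact: (salg_set0 (gsalg _)). Qed.

Lemma aeq_refl A : aeq A A.
Proof. by exists set0 => //; exact: negl_set0. Qed.

Lemma sinfty_negl A : sinfty F A -> Q A = 0%E -> negl A.
Proof. by move=> FA A0; exists A; split => //; exact: sinfty_terminal. Qed.

Context (gF : good_filtration Q F) (mtau : measurable_fun setT tau).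

Lemma terminal_measurable : terminal `<=` measurable.
Proof.
apply: gsalg_sub; first exact: sigma_algebra_measurable.
move=> A [[B [mB ->]]|]; last exact: (sinfty_measurable gF).
by rewrite -[X in measurable X]setTI; exact: mtau.
Qed.

Lemma negl_bigcup (A : nat -> set Omega) : (forall n, negl (A n)) -> negl (\bigcup_n A n).
Proof.
move=> /choice[B BP]; exists (\bigcup_n B n); split.
- by apply: salg_bigcup; [exact: gsalg|move=> n; case: (BP n)].
- by apply: measure_bigcup0 => n; [apply: terminal_measurable|]; case: (BP n).
- by apply: subset_bigcup => n _; case: (BP n).
Qed.

Lemma negl_setU A B : negl A -> negl B -> negl (A `|` B).
Proof.
by move=> nA nB; rewrite -bigcup2E; apply: negl_bigcup => -[|[|n]] //=; exact: negl_set0.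
Qed.

Lemma negl_Qnull A : negl A -> Qnull Q A.
Proof. by move=> [B [KB B0 AB]]; exists B; split => //; exact: terminal_measurable. Qed.

Lemma negl_Nsig A : negl A -> Nsig Q F tau A.
Proof.
move=> [B [KB B0 AB]]; apply: sub_sigma_algebra; exists B; split => //; split => //.
exact: terminal_measurable.
Qed.

(** The target class for generator arguments that replace an event of a completed sigma-algebra by
    one of the uncompleted sigma-algebra, up to [negl]. *)
Lemma completion_salg H : sigma_algebra setT H ->
  sigma_algebra setT [set B | exists2 A, H A & aeq B A].
Proof.
move=> HS; split.
- by exists set0; [exact: salg_set0|exact: aeq_refl].
- move=> B [A HA [N nN NBA]]; exists (~` A); first exact: salg_setC.
  by exists N => // w /NBA BA; rewrite setTD; split => nB /BA.
- move=> B BH; have /choice[AN ANP] : forall n, exists AN : set Omega * set Omega,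
    [/\ H AN.1, negl AN.2 & forall w, ~ AN.2 w -> (B n w <-> AN.1 w)].
    by move=> n; have [A HA [N nN NBA]] := BH n; exists (A, N).
  exists (\bigcup_n (AN n).1); first by apply: salg_bigcup => // n; case: (ANP n).
  exists (\bigcup_n (AN n).2); first by apply: negl_bigcup => n; case: (ANP n).
  move=> w nN; split => -[n _ h]; exists n => //; have [_ _ hn] := ANP n.
    by apply/hn => // Nw; apply: nN; exists n.
  by apply/hn => // Nw; apply: nN; exists n.
Qed.

Lemma Nsig_completion H : sigma_algebra setT H ->
  Nsig Q F tau `<=` [set B | exists2 A, H A & aeq B A].
Proof.
move=> HS; apply: gsalg_sub; first exact: completion_salg.
move=> B [A [KA [mA [A0 BA]]]]; exists set0; first exact: salg_set0.
exists A; first by exists A; split.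
by move=> w nA; split => [/BA /nA|[]].
Qed.

Lemma Gfilt_salg t : sigma_algebra setT (Gfilt Q F tau t).
Proof. exact: gsalg. Qed.

Lemma negl_Gfilt t A : negl A -> Gfilt Q F tau t A.
Proof. by move=> /negl_Nsig nA; apply: sub_sigma_algebra; left. Qed.

Lemma Gfilt_aeq t A B : Gfilt Q F tau t B -> aeq A B -> Gfilt Q F tau t A.
Proof.
move=> GB [N nN NAB]; have GS := Gfilt_salg t.
have -> : A = (B `\` N) `|` (A `&` N).
  apply/seteqP; split => w.
    by move=> Aw; have [Nw|nNw] := pselect (N w); [right|left; split => //; exact/NAB].
  by move=> [[Bw nNw]|[]//]; exact/NAB.
apply: (salg_setU GS); first by apply: (salg_setD GS) => //; exact: negl_Gfilt.
by apply: negl_Gfilt; apply: negl_sub nN _ => w [].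
Qed.

Lemma Gfilt_le (s t : R) : s <= t -> Gfilt Q F tau s `<=` Gfilt Q F tau t.
Proof.
move=> st; apply: sub_sigma_algebra2 => A [nA|hA]; [by left|right => r /= tr].
by apply: hA; exact: le_lt_trans tr.
Qed.

Lemma Gfilt_Ginf (t : R) : 0 <= t -> Gfilt Q F tau t `<=` Ginf Q F tau.
Proof. by move=> t0 A GA; apply: sub_sigma_algebra; exists t. Qed.

Lemma Ginf_salg : sigma_algebra setT (Ginf Q F tau).
Proof. exact: gsalg. Qed.

Lemma filt_Gfilt (t : R) : 0 <= t -> F t `<=` Gfilt Q F tau t.
Proof.
move=> t0 A FA; apply: sub_sigma_algebra; right => s /= ts.
by apply: sub_sigma_algebra; left; apply: (filt_le gF t0 (ltW ts)).
Qed.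

Lemma stopping_time_Gfilt (T : Omega -> \bar R) :
  stopping_time F T -> stopping_time (Gfilt Q F tau) T.
Proof. by move=> [T0 FT]; split => // t t0; apply: filt_Gfilt => //; exact: FT. Qed.

Lemma tau_min_Gfilt (t : R) (V : set (\bar R)) : measurable V ->
  Gfilt Q F tau t [set w | V (Order.min (tau w) t%:E)].
Proof.
move=> mV; apply: sub_sigma_algebra; right => s /= ts.
apply: sub_sigma_algebra; right; exists [set x | V (Order.min x t%:E)]; split.
  rewrite -[X in measurable X]setTI.
  by apply: (@measurable_mine _ (\bar R) R setT id (cst t%:E)).
apply/seteqP; split => w /=;
  by rewrite -minA [Order.min s%:E _]minC (@min_l _ _ t%:E)// lee_fin ltW.
Qed.

(** The filtration only shows [tau] truncated at finite times. The truncation at [n] is [tau] itself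
    on [{tau <= n}], and off all these events [tau] is [+oo]. *)
Lemma terminal_Ginf : terminal `<=` Ginf Q F tau.
Proof.
apply: gsalg_sub; first exact: Ginf_salg.
move=> A [[B [mB ->]]|]; last first.
  apply: gsalg_sub; first exact: Ginf_salg.
  by move=> {}A [t /= t0 FA]; apply: (Gfilt_Ginf t0); exact: filt_Gfilt.
have tau_oo w : (\bigcap_n ~` [set w | (tau w <= n%:R%:E)%E]) w -> tau w = +oo%E.
  move=> h; case tw : (tau w) => [x||] //.
    have /negP := h (Num.bound `|x|) I; rewrite /= tw lee_fin -ltNge => hx.
    by have := lt_trans (archi_boundP (normr_ge0 x)) hx; rewrite ltNge ler_norm.
  by exfalso; apply: (h 0%N I); rewrite /= tw leNye.
have GT n : Ginf Q F tau [set w | (tau w <= n%:R%:E)%E].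
  (* Truncation at [n + 1] is needed, since truncation at [n] never exceeds [n]. *)
  apply: (Gfilt_Ginf (ler0n R n.+1)).
  have -> : [set w | (tau w <= n%:R%:E)%E] =
      [set w | [set x | (x <= n%:R%:E)%E] (Order.min (tau w) n.+1%:R%:E)].
    apply/seteqP; split => w /=; first by rewrite ge_min => ->.
    by rewrite ge_min => /orP[//|]; rewrite lee_fin ler_nat ltnn.
  apply: tau_min_Gfilt; rewrite -[X in measurable X]setTI.
  exact: emeasurable_fun_infty_c.
have -> : tau @^-1` B = (\bigcup_n ([set w | (tau w <= n%:R%:E)%E] `&`
    [set w | B (Order.min (tau w) n%:R%:E)])) `|`
    ((\bigcap_n ~` [set w | (tau w <= n%:R%:E)%E]) `&` [set w | B +oo%E]).
  apply/seteqP; split => w /=; last first.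
    by move=> [[n _ [/= tn]]|[h]]; [rewrite min_l|rewrite tau_oo].
  have [tn|tn] := pselect (exists n, (tau w <= n%:R%:E)%E).
    by case: tn => n tn Bw; left; exists n => //=; rewrite min_l.
  have h : (\bigcap_n ~` [set w | (tau w <= n%:R%:E)%E]) w by move=> n _ /= h; apply: tn; exists n.
  by rewrite tau_oo => // Bw; right.
have GS := Ginf_salg.
apply: (salg_setU GS).
  apply: (salg_bigcup GS) => n; apply: (salg_setI GS) => //.
  by apply: (Gfilt_Ginf (ler0n R n)); exact: tau_min_Gfilt.
apply: (salg_setI GS); first by apply: (salg_bigcap GS) => n; exact: (salg_setC GS).
have [Boo|nBoo] := pselect (B +oo%E).
  by rewrite (_ : mkset _ = setT); [exact: (salg_setT GS)|apply/seteqP; split].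
by rewrite (_ : mkset _ = set0); [exact: (salg_set0 GS)|apply/seteqP; split].
Qed.

Lemma Gfilt_completion (t s : R) : t < s -> Gfilt Q F tau t `<=` [set B | exists2 A,
  sjoin (F s) (sigma_rv (fun w => Order.min (tau w) s%:E)) A & aeq B A].
Proof.
move=> ts; have HS : sigma_algebra setT
    (sjoin (F s) (sigma_rv (fun w => Order.min (tau w) s%:E))) by exact: gsalg.
apply: gsalg_sub; first exact: completion_salg.
move=> A [|/(_ s ts) hA]; first exact: Nsig_completion.
by exists A => //; exact: aeq_refl.
Qed.

Lemma Ginf_completion : Ginf Q F tau `<=` [set B | exists2 A, terminal A & aeq B A].
Proof.
have KS : sigma_algebra setT terminal by exact: gsalg.
have CS := completion_salg KS.
apply: gsalg_sub => // A [t /= t0 GA].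
have [B hB AB] := Gfilt_completion (ltr_pwDr ltr01 (lexx t) : t < t + 1) GA.
exists B => //; move: {A GA AB} B hB; apply: gsalg_sub => // A [FA|[V [mV ->]]].
  by apply: sinfty_terminal; apply: (@filt_sinfty _ _ _ F (t + 1)) => //; rewrite addr_ge0.
apply: sigma_rv_terminal; exists [set x | V (Order.min x (t + 1)%:E)]; split => //.
rewrite -[X in measurable X]setTI.
by apply: (@measurable_mine _ (\bar R) R setT id (cst (t + 1)%:E)).
Qed.

(** The equivalence of [Q'] and [Q] is phrased with [Qnull]; for events of [Ginf] this upgrades to
    [negl]. Such an [A] agrees with a terminal [B] off a terminal null set [M], and [B] is covered
    by [C] and [M], hence null. *)
Lemma Ginf_Qnull_negl A : Ginf Q F tau A -> Qnull Q A -> negl A.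
Proof.
move=> /Ginf_completion[B KB [N [M [KM M0 NM]] NAB]] [C [mC [C0 AC]]].
have mB := terminal_measurable KB; have mM := terminal_measurable KM.
exists (B `|` M); split.
- exact: (salg_setU (gsalg _) KB KM).
- apply: (@subset_measure0 _ _ _ _ _ (C `|` M)).
  + exact: measurableU.
  + exact: measurableU.
  + move=> w [Bw|Mw]; last by right.
    have [Nw|nNw] := pselect (N w); first by right; exact: NM.
    by left; apply: AC; exact/NAB.
  + exact: null_set_setU.
- move=> w Aw; have [Nw|nNw] := pselect (N w); first by right; exact: NM.
  by left; exact/NAB.
Qed.

End enlarged_filtration.

(** * Splitting of conditional probabilities on [[S, T)] *)

Lemma measurable_fun_ge {R : realType} {d} {T : measurableType d} (f : T -> R) :
  (forall c, measurable [set x | c <= f x]) -> measurable_fun setT f.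
Proof.
move=> mf; apply: (measurability _ (RGenCInfty.measurableE R)).
move=> _ [_ [c ->] <-]; rewrite setTI.
rewrite (_ : _ @^-1` _ = [set x | c <= f x])//.
by apply/seteqP; split => x /=; rewrite in_itv /= andbT.
Qed.

Lemma bounded_integrable {R : realType} {d} {T : measurableType d} (P : probability T R)
    (A : set T) (f : T -> R) (M : R) :
  measurable A -> measurable_fun A f -> (forall w, A w -> `|f w| <= M) ->
  P.-integrable A (EFin \o f).
Proof.
move=> mA mf fM; apply: measurable_bounded_integrable => //.
  by rewrite ltey_eq fin_num_measure.
by exists M; split; [exact: num_real|move=> x Mx w /fM /le_trans]; apply; exact: ltW.
Qed.

Section transfer.
Context {R : realType} {d} {Omega : measurableType d} (Q : probability Omega R).
Context (F : R -> set (set Omega)) (tau T S : Omega -> \bar R).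
Context (gF : good_filtration Q F) (mtau : measurable_fun setT tau).
Context (FT : stopping_time F T) (GS : stopping_time (Gfilt Q F tau) S).
Context (tauS : negl Q F tau [set w | (S w < tau w)%E]).

Local Notation G := (Gfilt Q F tau).
Local Notation Oinf := (g_sigma_algebraType (Ginf Q F tau)).
Context (Q' : probability Oinf R) (sH : sH_measure Q F tau S T Q').

Lemma Ginf_measurable : Ginf Q F tau `<=` @measurable _ Oinf.
Proof. by move=> A GA; apply/measurable_gsalgE => //; exact: Ginf_salg. Qed.

(* The same fact at the type carrying [Q'], where unification would otherwise
   pick [Omega]. *)
Lemma Oinf_Gfilt_salg (t : R) : @sigma_algebra Oinf setT (G t).
Proof. exact: Gfilt_salg. Qed.

Lemma Gfilt_measurable (t : R) : 0 <= t -> G t `<=` @measurable _ Oinf.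
Proof. by move=> t0 A GA; apply: Ginf_measurable; exact: Gfilt_Ginf GA. Qed.

Lemma negl_Q' A : negl Q F tau A -> Ginf Q F tau A /\ Q' A = 0%E.
Proof.
move=> nA; have GA : Ginf Q F tau A.
  by apply: (@Gfilt_Ginf _ _ _ Q F tau 0) => //; exact: (negl_Gfilt gF).
by split => //; apply/(sH.1 A GA); exact: (negl_Qnull gF mtau).
Qed.

Lemma Q'_negl A : Ginf Q F tau A -> Q' A = 0%E -> negl Q F tau A.
Proof.
move=> GA A0; apply: (Ginf_Qnull_negl gF mtau) => //.
by apply/(sH.1 A GA).
Qed.

Lemma Q'_aeq A B : Ginf Q F tau A -> Ginf Q F tau B -> aeq Q F tau A B -> Q' A = Q' B.
Proof.
move=> GA GB [N nN NAB]; have [GN N0] := negl_Q' nN.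
have mN := Ginf_measurable GN.
suff le C D : Ginf Q F tau C -> Ginf Q F tau D -> (forall w, ~ N w -> C w -> D w) ->
    (Q' C <= Q' D)%E.
  by apply/eqP; rewrite eq_le !le// => w nw; exact: (NAB _ nw).2 || exact: (NAB _ nw).1.
move=> /Ginf_measurable mC /Ginf_measurable mD CD.
rewrite -(measureU0 mD mN N0); apply: le_measure; rewrite ?inE//; first exact: measurableU.
by move=> w Cw; have [Nw|nNw] := pselect (N w); [right|left; exact: CD].
Qed.

Definition active (t : R) : set Omega := [set w | (S w <= t%:E)%E /\ (t%:E < T w)%E].

Lemma active_Gfilt (t : R) : 0 <= t -> G t (active t).
Proof.
move=> t0; apply: (salg_setI (Gfilt_salg Q F tau t)); first exact: GS.2.
by apply: (filt_Gfilt gF) => //; exact: (stopping_time_gt gF FT).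
Qed.

Lemma active_tau (t : R) A (V : set (\bar R)) : G t A -> A `<=` active t -> measurable V ->
  G t (A `&` [set w | V (tau w)]).
Proof.
move=> GA At mV.
apply: (@Gfilt_aeq _ _ _ Q F tau gF mtau t _ (A `&` [set w | V (Order.min (tau w) t%:E)])) => //.
  by apply: (salg_setI (Gfilt_salg Q F tau t)) => //; exact: tau_min_Gfilt.
exists [set w | (S w < tau w)%E] => // w /negP; rewrite -leNgt => tS.
split => -[Aw Vw]; split => //; have [St _] := At _ Aw; move: Vw;
  by rewrite /= min_l// (le_trans tS).
Qed.

Section martingale_transfer.
Context (s : R) (s0 : 0 <= s) (B : set Omega) (FB : F s B).
Let C := B `&` [set w | (s%:E < T w)%E].
Context (X : R -> Omega -> R) (rX : forall w, rcll (X^~ w)).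
Context (X01 : forall t w, 0 <= X t w <= 1).
Context (XC : forall t : R, 0 <= t -> cprob_on Q (F t) setT C (EFin \o X t)).

Let FX (t : R) (t0 : 0 <= t) : @measurable_fun _ _ (g_sigma_algebraType (F t)) R setT (X t).
Proof. by have [mX _ _] := XC t0; exact/measurable_EFinP. Qed.

Let mX (t : R) (t0 : 0 <= t) : measurable_fun setT (X t).
Proof.
have Ft := filt_salg gF t0.
exact: (measurable_fun_gsalg Ft (salg_setT Ft) (filt_measurable gF t0) (FX t0)).
Qed.

Lemma martingale_local : local_martingale Q F X.
Proof.
split; first exact: rcll_cadlag.
have aX : adapted F X.
  move=> t t0 V mV; have Ft := filt_salg gF t0.
  apply/measurable_gsalgE => //; rewrite -[X in measurable X]setTI.
  exact: FX.
split=> //; exists (fun _ _ => +oo%E); split; [|split; [|split]].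
- move=> n; split => // t t0; rewrite (_ : mkset _ = set0); last by apply/seteqP; split.
  exact: (salg_set0 (filt_salg gF t0)).
- by [].
- by exists set0; split => //; split => // w _ r; exists 0%N; rewrite leey.
move=> n.
have -> : stopped (fun=> +oo%E) X = X.
  by apply/funext => t; apply/funext => w; rewrite /stopped minye.
split => //; split.
  move=> t t0; apply: (@bounded_integrable _ _ _ _ _ _ 1) => //; first exact: mX.
  by move=> w _; case/andP: (X01 t w) => ? ?; rewrite ger0_norm.
move=> u t u0 ut A FA; have t0 := le_trans u0 ut.
have [_ _ ->//] := XC t0; last exact: (filt_le gF u0 ut).
by have [_ _ ->] := XC u0.
Qed.

Let GX (t : R) (t0 : 0 <= t) : @measurable_fun _ _ Oinf R setT (X t).
Proof.
apply: (measurable_fun_gsalgS (filt_salg gF t0) (Ginf_salg Q F tau) _ _ (FX t0)).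
  exact: (salg_setT (filt_salg gF t0)).
by apply: subset_trans (Gfilt_Ginf t0); exact: (filt_Gfilt gF).
Qed.

(** The martingale part of the sH-property enters here: [X], a conditional probability for [(Q, F)],
    also computes that of [C] for [(Q', G)] on [[S, T)]. *)
Lemma cprob_transfer (t : R) A : 0 <= t -> G t A -> A `<=` active t ->
  (\int[Q']_(w in A) (X t w)%:E = Q' (A `&` C))%E.
Proof.
move=> t0 GA At; have mA := Gfilt_measurable t0 GA.
have [_ [aY [Tn [stTn [ndTn [[Nl [mNl [Nl0 NlP]]] martTn]]]]]] := sH.2 _ martingale_local.
set Y := stoch_int_proc S T X in aY martTn.
have Y1 u w : `|Y u w| <= 1.
  rewrite /Y /stoch_int_proc ler_distl.
  have /andP[? ?] := X01 (fine (Order.min (Order.max (S w) (T w)) u%:E)) w.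
  have /andP[? ?] := X01 (fine (Order.min (S w) u%:E)) w.
  by lra.
have mG (f : R -> Omega -> R) (u : R) : 0 <= u -> adapted G f ->
    @measurable_fun _ _ Oinf R A (f u).
  move=> u0 af; apply: (@measurable_funS _ _ Oinf R setT) => //.
  by move=> _ V mV; rewrite setTI; apply: (Gfilt_measurable u0); exact: af.
(* [Y] is bounded by 1, so the localizing sequence is removed by bounded convergence: off [Nl],
   [Tn n] eventually passes [u]. *)
have cvgY (u : R) : 0 <= u -> (\int[Q']_(w in A) (stopped (Tn n) Y u w)%:E
    @[n --> \oo] --> \int[Q']_(w in A) (Y u w)%:E)%E.
  move=> u0; apply: (@bounded_convergence _ _ _ Q' A Nl _ _ 1) => //.
  - by move=> n; apply: mG => //; case: (martTn n).
  - exact: mG.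
  - by move=> n w; exact: Y1.
  move=> w /NlP /(_ u)[n un]; apply: cvg_near_cst; exists n => // m /= nm.
  rewrite /stopped min_r//; apply: (le_trans un).
  elim: m nm => [|m IH]; first by rewrite leqn0 => /eqP ->.
  by rewrite leq_eqVlt => /predU1P[->//|/IH /le_trans]; apply; exact: ndTn.
have intY (u : R) : t <= u -> (\int[Q']_(w in A) (Y u w)%:E = \int[Q']_(w in A) (Y t w)%:E)%E.
  move=> tu; have u0 := le_trans t0 tu.
  have hu := cvgY u u0; have ht := cvgY t t0.
  have E : (fun n => \int[Q']_(w in A) (stopped (Tn n) Y u w)%:E)%E =
      (fun n => \int[Q']_(w in A) (stopped (Tn n) Y t w)%:E)%E.
    apply/funext => n; have [_ [_ mart]] := martTn n.
    exact: (mart t u t0 tu A GA).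
  rewrite E in hu.
  have lu := cvg_lim (@ereal_hausdorff R) hu.
  by rewrite -lu (cvg_lim (@ereal_hausdorff R) ht).
(* Late enough for [X] stopped at [T] to equal [\1_C]. On [A], where [S <= t < T], the values at [S]
   cancel in [Y u - Y t], which becomes [\1_C - X t]. *)
pose u := Num.max s t.
have su : s <= u by rewrite le_max lexx.
have tu : t <= u by rewrite le_max lexx orbT.
have u0 := le_trans t0 tu.
have [N [FN N0 NP]] := cprob_stopped_at_end gF FT s0 FB rX X01 XC.
have [GN Q'N0] := negl_Q' (sinfty_negl _ FN N0).
have GC : Ginf Q F tau C.
  apply: (Gfilt_Ginf s0); apply: (filt_Gfilt gF s0).
  by apply: (salg_setI (filt_salg gF s0)) => //; exact: (stopping_time_gt gF FT).
have mC := Ginf_measurable GC.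
have iY (v : R) : 0 <= v -> Q'.-integrable A (EFin \o Y v).
  by move=> v0; apply: (@bounded_integrable _ _ _ _ _ _ 1) => //; exact: mG.
have mXA : @measurable_fun _ _ Oinf R A (X t).
  by apply: (@measurable_funS _ _ Oinf R setT) => //; exact: GX.
have iX : Q'.-integrable A (EFin \o X t).
  apply: (@bounded_integrable _ _ _ _ _ _ 1) => // w _.
  by case/andP: (X01 t w) => ? ?; rewrite ger0_norm.
have m1C : @measurable_fun _ _ Oinf R A \1_C.
  by apply: (@measurable_indic _ Oinf R).
have i1C : Q'.-integrable A (EFin \o \1_C).
  apply: (@bounded_integrable _ _ _ _ _ _ 1) => // w _.
  by rewrite indicE; case: (w \in C); rewrite ?normr1 ?normr0.
have : (\int[Q']_(w in A) (\1_C w - X t w)%:E = 0)%E.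
  transitivity (\int[Q']_(w in A) (Y u w - Y t w)%:E)%E; last first.
    rewrite integralB_EFin ?intY//; try exact: iY.
    by rewrite subee//; apply: integrable_fin_num => //; exact: iY.
  apply: ae_eq_integral => //.
  - by apply/measurable_EFinP; exact: measurable_funB.
  - by apply/measurable_EFinP; apply: measurable_funB; exact: mG.
  exists N; split => //; first exact: Ginf_measurable.
  move=> w /= h; apply: contrapT => nN; apply: h => Aw.
  have [St tT] := At _ Aw.
  rewrite -(NP w nN u su) /Y /stoch_int_proc.
  have ST : (S w <= T w)%E by exact: le_trans St (ltW tT).
  rewrite (max_r ST) (min_r (ltW tT)) (min_l St) (min_l (le_trans St _)) ?lee_fin//=.
  by congr (_%:E); ring.
have f1 := integrable_fin_num mA i1C; have f2 := integrable_fin_num mA iX.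
rewrite integralB_EFin// => h.
transitivity (\int[Q']_(w in A) (\1_C w)%:E)%E.
  move: h f1 f2; set a := (\int[Q']_(w in A) (\1_C w)%:E)%E.
  set b := (\int[Q']_(w in A) (X t w)%:E)%E => h f1 f2.
  by apply/esym/eqP; move/eqP: h; rewrite sube_eq ?add0e ?fin_num_adde_defl.
by rewrite integral_indic// setIC.
Qed.

End martingale_transfer.

Local Notation Z Y := (fun (t : R) w => Y (tau w, (t, w))).

(** Trace form of [borel_optional F], a sigma-algebra on the whole type, so that measurability of
    total functions can be used. *)
Definition BOT : set (set (\bar R * (R * Omega))) := [set A | borel_optional F (Dprod `&` A)].

(** Only times of [[S, T)] are compared, because the maximal inequality for series controls the
    tails nowhere else. *)
Definition rc_active (f : R -> R) w := forall t, 0 <= t -> active t w -> forall e, 0 < e ->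
  exists2 r, 0 < r & forall u, t < u < t + r -> active u w -> `|f u - f t| <= e.

(* [C] has a conditional probability process with respect to [(Q', G)] on [[S, T)]
   which is split as in the definition of [Lo] and right-continuous. *)
Definition split_cprob (C : set Omega) (Y : \bar R * (R * Omega) -> R) :=
  [/\ (forall p, 0 <= Y p <= 1),
      @measurable_fun _ _ (g_sigma_algebraType BOT) R setT Y,
      (exists2 N, negl Q F tau N & forall w, ~ N w -> rc_active (fun t => Y (tau w, (t, w))) w) &
      forall t : R, 0 <= t -> cprob_on Q' (G t) (active t) C (EFin \o Z Y t)].

Lemma BOT_salg : sigma_algebra setT BOT.
Proof. by apply: trace_salg; exact: smallest_sigma_algebra. Qed.

Lemma split_cprobT : split_cprob setT (fun=> 1).
Proof.
split.
- by move=> p; rewrite ler01 lexx.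
- exact: measurable_cst.
- exists set0; first exact: negl_set0.
  by move=> w _ t t0 _ e e0; exists 1 => // u _ _; rewrite subrr normr0 ltW.
- move=> t t0; split.
  + exact: measurable_cst.
  + by move=> w _; rewrite lee_fin ler01.
  + move=> A GA _; rewrite integral_cst ?mul1e ?setIT//.
    exact: Gfilt_measurable GA.
Qed.

Lemma split_cprob_aeq C C' Y : Ginf Q F tau C -> Ginf Q F tau C' -> aeq Q F tau C C' ->
  split_cprob C Y -> split_cprob C' Y.
Proof.
move=> GC GC' [N nN NCC'] [Y01 mY rY YC]; split => // t t0; have [m1 m2 m3] := YC t t0.
split => // A GA At; rewrite m3//; have GiA := Gfilt_Ginf t0 GA.
have GIS := Ginf_salg Q F tau.
apply: Q'_aeq; [exact: (salg_setI GIS)|exact: (salg_setI GIS)|].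
by exists N => // w /NCC' CC'; split => -[Aw /CC'].
Qed.

Lemma split_cprobC C Y : Ginf Q F tau C -> split_cprob C Y ->
  split_cprob (~` C) (fun p => 1 - Y p).
Proof.
move=> GC [Y01 mY [N nN rY] YC]; split.
- by move=> p; case/andP: (Y01 p) => ? ?; rewrite subr_ge0 lerBlDr lerDl; apply/andP.
- by apply: measurable_funB => //; exact: measurable_cst.
- exists N => // w /rY rw t t0 It e e0; have [r r0 rt] := rw t t0 It e e0.
  exists r => // u tu Iu; rewrite [X in `|X|](_ : _ =
    Y (tau w, (t, w)) - Y (tau w, (u, w))); first by rewrite distrC; exact: rt.
  by ring.
- move=> t t0; have [m1 m2 m3] := YC t t0; split.
  + apply/measurable_EFinP; apply: measurable_funB; first exact: measurable_cst.
    exact/measurable_EFinP.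
  + by move=> w _; rewrite lee_fin; case/andP: (Y01 (tau w, (t, w))) => ? ?; rewrite subr_ge0.
  move=> A GA At; have mA := Gfilt_measurable t0 GA; have mC := Ginf_measurable GC.
  have mZ : @measurable_fun _ _ Oinf R A (Z Y t).
    have := cprob_on_measurable (Oinf_Gfilt_salg t) (Gfilt_measurable t0)
      (active_Gfilt t0) (YC t t0) GA At.
    by move=> /measurable_EFinP.
  have iZ : Q'.-integrable A (EFin \o Z Y t).
    apply: (@bounded_integrable _ _ _ _ _ _ 1) => // w _.
    by case/andP: (Y01 (tau w, (t, w))) => ? ?; rewrite ger0_norm.
  rewrite (_ : EFin \o _ = (fun w => (cst 1 w - Z Y t w)%:E))//.
  rewrite integralB_EFin//; last exact: finite_measure_integrable_cst.
  rewrite [X in (X - _)%E](_ : _ = Q' A); last by rewrite -[RHS]mul1e -integral_cst.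
  rewrite m3// -setDE.
  by rewrite (measureD mA mC)// ltey_eq fin_num_measure.
Qed.

Definition pi_sets : set (set Omega) := [set C | exists V s B,
  [/\ measurable V, 0 <= s, F s B &
      C = [set w | V (tau w)] `&` (B `&` [set w | (s%:E < T w)%E])]].

Lemma pi_sets_Ginf : pi_sets `<=` Ginf Q F tau.
Proof.
have GIS := Ginf_salg Q F tau.
move=> _ [V [s [B [mV s0 FB ->]]]]; apply: (salg_setI GIS).
  apply: (terminal_Ginf gF); apply: sub_sigma_algebra; left.
  by exists V.
apply: (Gfilt_Ginf s0); apply: (filt_Gfilt gF s0).
by apply: (salg_setI (filt_salg gF s0)) => //; exact: (stopping_time_gt gF FT).
Qed.

Lemma pi_sets_setI : setI_closed pi_sets.
Proof.
move=> _ _ [V [s [B [mV s0 FB ->]]]] [V' [s' [B' [mV' s0' FB' ->]]]].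
wlog ss' : V s B mV s0 FB V' s' B' mV' s0' FB' / s <= s'.
  move=> h; have [ss'|/ltW ss'] := leP s s'; first exact: h.
  by rewrite setIC; exact: h.
exists (V `&` V'), s', (B `&` B'); split => //.
- exact: measurableI.
- by apply: (salg_setI (filt_salg gF s0')) => //; exact: (filt_le gF s0 ss').
apply/seteqP; split => w /=.
  by move=> [[Vw [Bw sw]] [V'w [B'w s'w]]].
move=> [[Vw V'w] [[Bw B'w] s'w]]; do !split => //.
by apply: le_lt_trans s'w; rewrite lee_fin.
Qed.

Lemma pi_sets_split C : pi_sets C -> exists Y, split_cprob C Y.
Proof.
move=> [V [s [B [mV s0 FB ->]]]].
set C0 := B `&` _.
have mC0 : measurable C0.
  apply: (filt_measurable gF s0).
  by apply: (salg_setI (filt_salg gF s0)) => //; exact: (stopping_time_gt gF FT).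
have [X [X01 rX XC]] := rcll_cprob gF mC0.
(* At the point [tau w] the first factor is the indicator of [{tau in V}], and the second is the
   [(Q, F)]-conditional probability of the remaining factor [C0]. *)
exists (fun p => \1_[set p : \bar R * (R * Omega) | V p.1] p * X p.2.1 p.2.2); split.
- move=> p; rewrite indicE; case: (_ \in _); rewrite ?mul1r ?mul0r ?lexx ?ler01//.
- apply: measurable_funM.
    apply: measurable_indic; apply/measurable_gsalgE; first exact: BOT_salg.
    rewrite /BOT /=.
    rewrite (_ : Dprod `&` _ = [set q | (V `&` [set u | (0 <= u)%E]) q.1 /\ Dpos q.2]).
      apply: sub_sigma_algebra; exists (V `&` [set u | (0 <= u)%E]), Dpos; split.
        apply: measurableI => //; rewrite -[X in measurable X]setTI.
        exact: emeasurable_fun_c_infty.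
      split; first by move=> u [].
      split => //; rewrite -(setD0 Dpos).
      by apply: sigma_algebraCD; exact: sigma_algebra0.
    by apply/seteqP; split => q /=; [move=> [[]]|move=> [[]]].
  apply: measurable_fun_ge => c; apply/measurable_gsalgE; first exact: BOT_salg.
  rewrite /BOT /= (_ : Dprod `&` _ = [set q | [set u | (0 <= u)%E] q.1 /\
      [set p | 0 <= p.1 /\ c <= X p.1 p.2] q.2]).
    apply: sub_sigma_algebra.
    exists [set u | (0 <= u)%E], [set p | 0 <= p.1 /\ c <= X p.1 p.2]; split.
      by rewrite -[X in measurable X]setTI; exact: emeasurable_fun_c_infty.
    split => //; split => //; apply: (rcll_optional gF) => // t b t0.
      have Ft := filt_salg gF t0.
      by have := cprob_on_gt Ft (salg_setT Ft) b (XC t t0); rewrite setTI.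
    have Ft := filt_salg gF t0.
    have := salg_setC Ft (cprob_on_ge Ft (salg_setT Ft) b (XC t t0)).
    rewrite setTI; congr (F t _); apply/seteqP; split => w /=.
      by move=> /negP; rewrite -ltNge.
    by rewrite lee_fin => h; apply/negP; rewrite -ltNge.
  by apply/seteqP; split => q /=; [move=> [[]]|move=> [? []]].
- exists set0; first exact: negl_set0.
  move=> w _ t t0 _ e e0; have [r r0 rt] := (rX w).1 t t0 e e0.
  exists r => // u tu _ /=; rewrite indicE [in X in _ - X]indicE /=.
  have -> : ((tau w, (t, w)) \in [set p : \bar R * (R * Omega) | V p.1]) =
            ((tau w, (u, w)) \in [set p : \bar R * (R * Omega) | V p.1]).
    by apply/idP/idP => /set_mem h; apply/mem_set.
  case: (_ \in _); rewrite ?mul1r ?mul0r ?subrr ?normr0; first exact: rt.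
  exact: ltW.
move=> t t0; have GtS := Gfilt_salg Q F tau t; have It := active_Gfilt t0.
have ZE : (fun w => (\1_[set p : \bar R * (R * Omega) | V p.1] (tau w, (t, w)) * X t w)%:E) =
    (fun w => (X t w)%:E) \_ [set w | V (tau w)].
  apply/funext => w; rewrite /patch indicE.
  have -> : ((tau w, (t, w)) \in [set p : \bar R * (R * Omega) | V p.1]) =
            (w \in [set w | V (tau w)]).
    by apply/idP/idP => /set_mem h; apply/mem_set.
  by case: (_ \in _); rewrite ?mul1r ?mul0r.
have mXt : @measurable_fun _ _ (g_sigma_algebraType (G t)) R (active t) (X t).
  have [/measurable_EFinP mX _ _] := XC t t0.
  apply: (@measurable_funS _ _ (g_sigma_algebraType (G t)) R setT) => //.
  apply: (measurable_fun_gsalgS (filt_salg gF t0) GtS) mX.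
    exact: (salg_setT (filt_salg gF t0)).
  exact: (filt_Gfilt gF).
split.
(* [{tau in V}] is only known to be in [G t] after intersection with [active t], so the function is
   first replaced by one restricted there. *)
- rewrite [X in measurable_fun _ X]ZE.
  apply: (@eq_measurable_fun _ _ (g_sigma_algebraType (G t)) _ (active t)
    ((fun w => (X t w)%:E) \_ (active t `&` [set w | V (tau w)]))).
    move=> w /set_mem Iw; rewrite /patch in_setI mem_set//.
  have mIV : @measurable _ (g_sigma_algebraType (G t)) (active t `&` [set w | V (tau w)]).
    by apply/measurable_gsalgE => //; exact: (active_tau It (subset_refl _) mV).
  have mI : @measurable _ (g_sigma_algebraType (G t)) (active t) by exact/measurable_gsalgE.
  apply/(measurable_restrict _ mIV mI).
  apply: (@measurable_funS _ _ (g_sigma_algebraType (G t)) _ (active t)).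
  + exact/measurable_gsalgE.
  + by move=> w [].
  + exact/measurable_EFinP.
- move=> w _; rewrite lee_fin mulr_ge0//; case/andP: (X01 t w) => //.
move=> A GA At; rewrite [X in integral _ _ X]ZE -integral_mkcondr.
rewrite (@cprob_transfer s s0 B FB X rX X01 XC)//.
- by rewrite -setIA.
- exact: active_tau.
- by apply: subset_trans At => w [].
Qed.

End transfer.

(** * Disjoint unions: uniform convergence of series of versions *)

Section countable_unions.
Context {R : realType} {d} {Omega : measurableType d} (Q : probability Omega R).
Context (F : R -> set (set Omega)) (tau T S : Omega -> \bar R).

Section series_of_paths.
Context (w : Omega).
Local Notation rc := (fun f => rc_active T S f w).

Lemma active_right (t : R) : active T S t w ->
  exists2 r, 0 < r & forall u, t < u < t + r -> active T S u w.
Proof.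
move=> [St tT]; have [r r0 rT] : exists2 r, 0 < r & ((t + r)%:E <= T w)%E.
  move: tT; case: (T w) => [x||] // tx; last by exists 1 => //; rewrite leey.
  exists (x - t); first by rewrite subr_gt0 -lte_fin.
  by rewrite lee_fin addrC subrK.
exists r => // u /andP[tu ur]; split.
  by apply: (le_trans St); rewrite lee_fin ltW.
by apply: lt_le_trans rT; rewrite lte_fin.
Qed.

Lemma rc_activeD (f g : R -> R) : rc f -> rc g -> rc (fun u => f u + g u).
Proof.
move=> rf rg t t0 It e e0; have e20 : 0 < e / 2 by rewrite divr_gt0.
have [r r0 rt] := rf t t0 It _ e20; have [r' r'0 rt'] := rg t t0 It _ e20.
exists (Num.min r r'); first by rewrite lt_min r0.
move=> u /andP[tu]; rewrite -ltrBlDl lt_min !ltrBlDl => /andP[ur ur'] Iu.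
rewrite [X in `|X|](_ : _ = (f u - f t) + (g u - g t)); last by ring.
rewrite (le_trans (ler_normD _ _))// [leRHS]splitr lerD//.
  by apply: rt => //; rewrite tu.
by apply: rt' => //; rewrite tu.
Qed.

Lemma rc_active_sum (y : nat -> R -> R) m : (forall i, rc (y i)) ->
  rc (fun u => \sum_(0 <= i < m) y i u).
Proof.
move=> ry; elim: m => [|m IH].
  move=> t t0 It e e0; exists 1 => // u _ _.
  by rewrite !big_geq// subrr normr0 ltW.
have -> : (fun u => \sum_(0 <= i < m.+1) y i u) = (fun u => \sum_(0 <= i < m) y i u + y m u).
  by apply/funext => u; rewrite big_nat_recr.
exact: rc_activeD.
Qed.

(** A tail bound at rational times extends to every active time, since each finite sum is
    right-continuous and the terms are nonnegative. With a uniformly small tail, the sum inherits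
    right-continuity from a finite sum, and truncation at 1 does not increase differences. *)
Lemma rc_active_series (y : nat -> R -> R) : (forall i u, 0 <= y i u) -> (forall i, rc (y i)) ->
  (forall e, 0 < e -> exists n, forall k, active T S (qenum k) w ->
     (\sum_(i <oo) (y (i + n)%N (qenum k))%:E <= e%:E)%E) ->
  rc (fun u => fine (mine (\sum_(i <oo) (y i u)%:E)%E 1%E)).
Proof.
move=> y0 ry tail.
have tailu e : 0 < e -> exists n, forall u, 0 <= u -> active T S u w ->
    exists2 x, 0 <= x <= e & (\sum_(i <oo) (y (i + n)%N u)%:E = x%:E)%E.
  move=> e0; have e20 : 0 < e / 2 by rewrite divr_gt0.
  have [n nk] := tail _ e20; exists n => u u0 Iu.
  have le_e : (\sum_(i <oo) (y (i + n)%N u)%:E <= e%:E)%E.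
    apply: lime_le; first by apply: is_cvg_nneseries => i _ _; rewrite lee_fin.
    near=> m; rewrite sumEFin lee_fin.
    have [r r0 rt] := rc_active_sum m (fun i => ry (i + n)%N) u0 Iu e20.
    have [r' r'0 rI] := active_right Iu.
    have [|k /andP[uk]] := @qenum_dense _ u (Num.min (u + r) (u + r')) u0.
      by rewrite lt_min !ltrDl r0.
    rewrite lt_min => /andP[kr kr'].
    have Ik : active T S (qenum k) w by apply: rI; rewrite uk.
    have := rt (qenum k); rewrite uk kr => /(_ isT Ik).
    rewrite ler_distl => /andP[+ _]; rewrite lerBlDr => /le_trans; apply.
    rewrite [leRHS]splitr lerD2r -lee_fin -sumEFin; apply: le_trans (nk k Ik).
    by apply: nneseries_lim_ge => i _ _; rewrite lee_fin.
  have ge0 : (0 <= \sum_(i <oo) (y (i + n)%N u)%:E)%E.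
    by apply: nneseries_ge0 => i _ _; rewrite lee_fin.
  move: le_e ge0; case: (\sum_(i <oo) _)%E => [x||] // xe x0.
  by exists x => //; rewrite -!lee_fin x0.
move=> t t0 It e e0; have e20 : 0 < e / 2 by rewrite divr_gt0.
have [n nP] := tailu _ e20.
have [r r0 rt] := rc_active_sum n ry t0 It e20.
have sumE u : 0 <= u -> active T S u w -> exists2 x, 0 <= x <= e / 2 &
    fine (mine (\sum_(i <oo) (y i u)%:E)%E 1%E) =
    Num.min (\sum_(0 <= i < n) y i u + x) 1.
  move=> u0 Iu; have [x x0 xE] := nP u u0 Iu; exists x => //.
  rewrite (@nneseries_split _ _ 0%N n); last by move=> i _; rewrite lee_fin.
  rewrite add0n -(@nneseries_addn _ (fun i => (y i u)%:E)); last by move=> i; rewrite lee_fin.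
  by rewrite xE sumEFin -EFinD -EFin_min.
exists r => // u tu Iu; have /andP[tu1 _] := tu.
have [x /andP[x0 xe] ->] := sumE t t0 It.
have [z /andP[z0 ze] ->] := sumE u (le_trans t0 (ltW tu1)) Iu.
have := rt u tu Iu; rewrite !ler_distl => /andP[h1 h2].
have ee : e = e / 2 + e / 2 by exact: splitr.
set p := \sum_(0 <= i < n) y i u in h1 h2 *; set q := \sum_(0 <= i < n) y i t in h1 h2 *.
by rewrite !minEle; case: ifP => ?; case: ifP => ?; apply/andP; split; lra.
Unshelve. all: by end_near. Qed.

End series_of_paths.

Context (gF : good_filtration Q F) (mtau : measurable_fun setT tau).
Context (FT : stopping_time F T) (GS : stopping_time (Gfilt Q F tau) S).
Local Notation G := (Gfilt Q F tau).
Local Notation Oinf := (g_sigma_algebraType (Ginf Q F tau)).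
Context (Q' : probability Oinf R) (sH : sH_measure Q F tau S T Q').

Let GM (t : R) (t0 : 0 <= t) : G t `<=` @measurable _ Oinf :=
  @Gfilt_measurable R d Omega Q F tau t t0.

(** The tail sum [W n] is a version for the remaining union [D n], which decreases to the empty set.
    The paths [E n e] whose tail exceeds [e] at some rational time of [[S, T)] have measure at most
    [Q' (D n) / e]. So for each [e = 1/(j+1)] almost every path avoids [E n e] for some [n], which
    is the tail bound required by [rc_active_series]. *)
Lemma split_cprobU (C : nat -> set Omega) (Y : nat -> \bar R * (R * Omega) -> R) :
  trivIset setT C -> (forall n, Ginf Q F tau (C n)) ->
  (forall n, split_cprob T S Q' (C n) (Y n)) ->
  split_cprob T S Q' (\bigcup_n C n) (fun p => fine (mine (\sum_(i <oo) (Y i p)%:E)%E 1%E)).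
Proof.
move=> tC GC YC.
have Y01 i p : 0 <= Y i p <= 1 by case: (YC i).
have Y0 i p : (0 <= (Y i p)%:E)%E by rewrite lee_fin; case/andP: (Y01 i p).
have mC n := Ginf_measurable (GC n).
pose D n := \bigcup_i C (i + n)%N.
have mD n : @measurable _ Oinf (D n) by apply: bigcup_measurable => i _; exact: mC.
pose W n (t : R) w := (\sum_(i <oo) (Y (i + n)%N (tau w, (t, w)))%:E)%E.
have WD n (t : R) : 0 <= t -> cprob_on Q' (G t) (active T S t) (D n) (W n t).
  move=> t0; split.
  - apply: (@ge0_emeasurable_sum _ (g_sigma_algebraType (G t)) R _
      (fun i w => (Y (i + n)%N (tau w, (t, w)))%:E)).
      by move=> i w _ _; exact: Y0.
    by move=> i _; have [_ _ _ /(_ t t0)[]] := YC (i + n)%N.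
  - by move=> w _; apply: nneseries_ge0 => i _ _; exact: Y0.
  move=> A GA At; have mA := GM t0 GA.
  rewrite (@integral_nneseries _ Oinf R Q' A mA (fun i w => (Y (i + n)%N (tau w, (t, w)))%:E)).
  - rewrite /D setI_bigcupr measure_semi_bigcup.
    + by apply: eq_eseriesr => i _; have [_ _ _ /(_ t t0)[_ _ ->]] := YC (i + n)%N.
    + by move=> i; apply: measurableI.
    + apply/trivIsetP => i j _ _ ij; rewrite setIACA.
      move/trivIsetP : tC => /(_ (i + n)%N (j + n)%N I I) ->; first by rewrite setI0.
      by rewrite eqn_add2r.
    + by apply: bigcup_measurable => i _; apply: measurableI.
  - move=> i; have [_ _ _ /(_ t t0) vi] := YC (i + n)%N.
    exact: (cprob_on_measurable (Oinf_Gfilt_salg Q F tau t) (GM t0)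
      (active_Gfilt gF FT GS t0) vi GA At).
  - by move=> i w _; exact: Y0.
pose E n (e : R) := \bigcup_k (active T S (qenum k) `&` [set w | (e%:E < W n (qenum k) w)%E]).
have GE n e : Ginf Q F tau (E n e).
  apply: (salg_bigcup (Ginf_salg Q F tau)) => k.
  have q0 := qenum_ge0 k : 0 <= qenum k :> R.
  apply: (Gfilt_Ginf q0); apply: cprob_on_gt (WD n _ q0); first exact: Oinf_Gfilt_salg.
  exact: (active_Gfilt gF FT GS q0).
have mE n e := Ginf_measurable (GE n e).
have prE n e : 0 < e -> e * pr Q' (E n e) <= pr Q' (D n).
  move=> e0.
  have := @first_time_inequality _ _ Oinf Q' G (fun t _ => Gfilt_salg Q F tau t)
    GM (fun s t _ => @Gfilt_le _ _ _ Q F tau s t)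
    (fun t => active T S t `&` [set w | (e%:E < W n t w)%E]) setT (D n) e 1
    measurableT (mD n) e0 ler01.
  rewrite setIT mul1r => /(_ _ _)/wrap[].
  - move=> t t0; apply: cprob_on_gt (WD n _ t0); first exact: Oinf_Gfilt_salg.
    exact: (active_Gfilt gF FT GS t0).
  - move=> t A t0 GA AB; rewrite setIT mul1r.
    apply: (cprob_on_ge_pr (Oinf_Gfilt_salg Q F tau t) (GM t0)
      (active_Gfilt gF FT GS t0) (mD n) (WD n t t0)) => //; first exact: ltW.
    + by move=> w /AB[].
    + by move=> w /AB[_ /ltW].
  move=> /le_trans; apply; apply: pr_le => //.
  by apply: measurableI => //; exact: mE.
have prD e : 0 < e -> exists n, pr Q' (D n) <= e.
  move=> e0; have capD : \bigcap_n D n = set0.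
    apply/seteqP; split => // w Dw; have [i _ Ci] := Dw 0%N I.
    have [j _ Cj] := Dw (i + 0).+1 I.
    have ij : (i + 0)%N = (j + (i + 0).+1)%N.
      by apply: tC => //; exists w.
    by move: (leq_addl j (i + 0).+1); rewrite -ij ltnn.
  have : Q' \o D @ \oo --> Q' (\bigcap_n D n).
    apply: nonincreasing_cvg_mu => //.
    - by rewrite ltey_eq fin_num_measure.
    - by rewrite capD.
    - move=> n m nm; apply/subsetPset => w [i _ Ci]; exists (i + (m - n))%N => //.
      by rewrite -addnA subnK.
  rewrite capD measure0 => /fine_cvgP[_ /cvgrPdist_le/(_ e e0)[n _ /(_ n (leqnn _))]].
  by rewrite /= sub0r normrN => h; exists n; apply: le_trans h; exact: ler_norm.
have neglE j : negl Q F tau (\bigcap_n E n j.+1%:R^-1).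
  apply: (Q'_negl gF mtau sH).
    by apply: (salg_bigcap (Ginf_salg Q F tau)) => n; exact: GE.
  have j0 : 0 < j.+1%:R^-1 :> R by rewrite invr_gt0.
  apply: pr_bigcap0 => [n|e e0]; first exact: mE.
  have [n ne] := prD _ (mulr_gt0 j0 e0); exists n.
  by rewrite -(ler_pM2l j0); apply: le_trans ne; exact: prE.
have /choice[N NP] n : exists N, negl Q F tau N /\
    forall w, ~ N w -> rc_active T S (fun t => Y n (tau w, (t, w))) w.
  by have [_ _ [N nN rN] _] := YC n; exists N.
split.
- move=> p; have s0 : (0 <= \sum_(i <oo) (Y i p)%:E)%E.
    by apply: nneseries_ge0 => i _ _; exact: Y0.
  rewrite -!lee_fin fineK.
    by rewrite ge_min le_min lexx s0 lee_fin ler01 orbT.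
  rewrite ge0_fin_numE; first by rewrite gt_min ltry orbT.
  by rewrite le_min s0 lee_fin ler01.
- apply: measurableT_comp; first exact: fine_measurable.
  apply: measurable_mine => //.
  apply: (@ge0_emeasurable_sum _ (g_sigma_algebraType (BOT F)) R _ (fun i p => (Y i p)%:E)).
    by move=> i p _ _; exact: Y0.
  by move=> i _; apply/measurable_EFinP; have [_ + _ _] := YC i.
- exists ((\bigcup_j \bigcap_n E n j.+1%:R^-1) `|` \bigcup_n N n).
    by apply: negl_setU => //; apply: negl_bigcup => // n; case: (NP n).
  move=> w nN; apply: (rc_active_series (y := fun i t => Y i (tau w, (t, w)))).
  + by move=> i u; case/andP: (Y01 i (tau w, (u, w))).
  + by move=> i; have [_] := NP i; apply => Nw; apply: nN; right; exists i.
  move=> e e0; have [j je] := ltr_add_invr e0.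
  have : ~ (\bigcap_n E n j.+1%:R^-1) w by move=> Ew; apply: nN; left; exists j.
  move=> /existsNP[n /not_implyP[_ nE]]; exists n => k Ik.
  apply: (@le_trans _ _ (j.+1%:R^-1)%:E); last by rewrite lee_fin ltW// -[ltLHS]add0r.
  rewrite leNgt; apply/negP => h; apply: nE.
  by exists k.
move=> t t0.
have W0 := WD 0%N t t0.
have := cprob_on_min1 (Oinf_Gfilt_salg Q F tau t) (GM t0)
  (active_Gfilt gF FT GS t0) (mD 0%N) W0.
have -> : D 0%N = \bigcup_n C n by apply: eq_bigcupr => i _; rewrite addn0.
congr (cprob_on _ _ _ _ _); apply/funext => w.
have -> : W 0%N t w = (\sum_(i <oo) (Y i (tau w, (t, w)))%:E)%E.
  by apply: eq_eseriesr => i _; rewrite addn0.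
rewrite /= fineK// ge0_fin_numE; first by rewrite gt_min ltry orbT.
rewrite le_min lee_fin ler01 andbT.
by apply: nneseries_ge0 => i _ _; exact: Y0.
Qed.

End countable_unions.

(** * Splitting of optional sets *)

Section optional_splitting.
Context {R : realType} {d} {Omega : measurableType d} (Q : probability Omega R).
Context (F : R -> set (set Omega)) (tau T S : Omega -> \bar R).
Context (gF : good_filtration Q F) (mtau : measurable_fun setT tau).
Context (FT : stopping_time F T) (GS : stopping_time (Gfilt Q F tau) S).
Context (tauS : negl Q F tau [set w | (S w < tau w)%E]).
Local Notation G := (Gfilt Q F tau).
Local Notation Oinf := (g_sigma_algebraType (Ginf Q F tau)).
Context (Q' : probability Oinf R) (sH : sH_measure Q F tau S T Q').

Let GM (t : R) (t0 : 0 <= t) : G t `<=` @measurable _ Oinf :=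
  @Gfilt_measurable R d Omega Q F tau t t0.
Let Gs (t : R) : @sigma_algebra Oinf setT (G t) := @Gfilt_salg R d Omega Q F tau t.
Let Ga (t : R) (t0 : 0 <= t) : G t (active T S t) := active_Gfilt gF FT GS t0.

Local Notation pis := <<s pi_sets F tau T >>.

(** Membership in [Ginf] is carried through the Dynkin argument because closure under complements
    and unions uses that the events are measurable for [Q']. *)
Lemma sigma_pi_sets_split C : pis C ->
  Ginf Q F tau C /\ exists Y, split_cprob T S Q' C Y.
Proof.
rewrite -setI_closed_g_dynkin_g_sigma_algebra; last exact: (pi_sets_setI gF).
apply: (smallest_sub (X := [set C | Ginf Q F tau C /\ exists Y, split_cprob T S Q' C Y])).
  have GIS := Ginf_salg Q F tau.
  split.
  - by split; [exact: (salg_setT GIS)|exists (fun=> 1); exact: split_cprobT].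
  - move=> A [GA [Y YA]]; split; first exact: (salg_setC GIS).
    by exists (fun p => 1 - Y p); exact: (split_cprobC gF FT GS).
  - move=> A tA AP; split; first by apply: (salg_bigcup GIS) => n; case: (AP n).
    have /choice[Y YP] n : exists Y, split_cprob T S Q' (A n) Y by case: (AP n).
    eexists; apply: (split_cprobU gF mtau FT GS sH tA) YP => n.
    by case: (AP n).
move=> {}C piC; split; first exact: (pi_sets_Ginf gF FT piC).
exact: (pi_sets_split gF mtau FT GS tauS sH).
Qed.

Local Notation pisc := [set B | exists2 A, pis A & aeq Q F tau B A].

Lemma completed_pi_sets_split C : pisc C -> Ginf Q F tau C ->
  exists Y, split_cprob T S Q' C Y.
Proof.
move=> [A pA [N nN NCA]] GC; have [GA [Y YA]] := sigma_pi_sets_split pA.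
exists Y; apply: (split_cprob_aeq gF mtau sH GA GC _ YA).
by exists N => // w /NCA[]; split.
Qed.

(** Up to a negligible set, [B] belongs to the sigma-algebra generated by [F s] and [tau] truncated
    at [s]; the strict [p < s] is due to the right limit in the definition of [Gfilt]. Traces of its
    generators on [{s < T}] are pi-sets. *)
Lemma Gfilt_trace_pi_sets (p s : R) B : 0 <= s -> p < s -> G p B ->
  pisc (B `&` [set w | (s%:E < T w)%E]).
Proof.
move=> s0 ps GB; have [A hA [N nN NBA]] := Gfilt_completion gF mtau ps GB.
exists (A `&` [set w | (s%:E < T w)%E]); last first.
  by exists N => // w /NBA BA; split => -[/BA].
pose D := [set w | (s%:E < T w)%E].
have pS : sigma_algebra setT pis by exact: gsalg.
have base V B' : measurable V -> F s B' -> pis ([set w | V (tau w)] `&` (B' `&` D)).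
  by move=> mV FB'; apply: sub_sigma_algebra; exists V, s, B'.
have Fs := filt_salg gF s0.
have pD : pis D.
  have := base setT setT measurableT (salg_setT Fs).
  by rewrite setTI (_ : [set w | _] = setT) ?setTI//; apply/seteqP; split.
suff : sjoin (F s) (sigma_rv (fun w => Order.min (tau w) s%:E)) `<=`
    [set A | pis (A `&` D)] by exact.
apply: gsalg_sub.
  split => /=.
  - by rewrite set0I; exact: (salg_set0 pS).
  - move=> E pE; rewrite (_ : _ `&` D = D `\` (E `&` D)); first exact: (salg_setD pS).
    by rewrite setTD setDIr setDv setU0 setDE setIC.
  - by move=> E pE; rewrite setI_bigcupl; exact: (salg_bigcup pS).
move=> E [FE|[V [mV ->]]] /=.
  have := base setT E measurableT FE.
  by rewrite (_ : [set w | _] = setT) ?setTI//; apply/seteqP; split.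
have mV' : measurable [set x | V (Order.min x s%:E)].
  rewrite -[X in measurable X]setTI.
  by apply: (@measurable_mine _ (\bar R) R setT id (cst s%:E)).
by have := base _ setT mV' (salg_setT Fs); rewrite setTI.
Qed.

Context (U : Omega -> \bar R) (GU : stopping_time G U).

Definition before (q : R) : set Omega := [set w | (U w <= q%:E)%E /\ (U w < T w)%E].

(** [U < T] is witnessed by two rationals [k < l] with [U <= k] and [l < T]. The gap between them is
    the strict inequality that [Gfilt_trace_pi_sets] asks for. *)
Lemma before_split (q : R) : 0 <= q ->
  Ginf Q F tau (before q) /\ exists Y, split_cprob T S Q' (before q) Y.
Proof.
move=> q0.
have beforeE : before q = \bigcup_k \bigcup_(l in [set l | qenum k < qenum l :> R])
    ([set w | (U w <= (Num.min q (qenum k))%:E)%E] `&` [set w | ((qenum l)%:E < T w)%E]).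
  apply/seteqP; split => w /=.
    move=> [Uq UT]; have U0 := GU.1 w.
    case Uw : (U w) Uq UT U0 => [x||] // xq xT x0.
    have [y xy yT] : exists2 y, x < y & (y%:E <= T w)%E.
      move: xT; case: (T w) => [y||] //; rewrite ?lte_fin => xy; first by exists y.
      by exists (x + 1); rewrite ?leey// ltrDl.
    have [k /andP[xk ky]] := qenum_dense (x0 : 0 <= x) xy.
    have [l /andP[kl ly]] := qenum_dense (qenum_ge0 k) ky.
    exists k => //; exists l => //; split => /=.
      by rewrite Uw lee_fin le_min -[x <= q]lee_fin xq ltW.
    by apply: lt_le_trans yT; rewrite lte_fin.
  move=> [k _ [l /= kl [/= Uqk lT]]]; split.
    by apply: le_trans Uqk _; rewrite lee_fin ge_min lexx.
  apply: le_lt_trans Uqk _; apply: le_lt_trans lT.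
  by rewrite lee_fin ge_min (ltW kl) orbT.
have min0 k : 0 <= Num.min q (qenum k) by rewrite le_min q0 qenum_ge0.
have mink k l : qenum k < qenum l :> R -> Num.min q (qenum k) < qenum l.
  by move=> kl; rewrite gt_min kl orbT.
have GB : Ginf Q F tau (before q).
  have GIS := Ginf_salg Q F tau.
  rewrite beforeE; apply: (salg_bigcup GIS) => k; apply: (salg_bigcup_in GIS) => l /= kl.
  apply: (salg_setI GIS); first exact: (Gfilt_Ginf (min0 k) (GU.2 _ (min0 k))).
  have l0 := qenum_ge0 l : 0 <= qenum l :> R.
  apply: (Gfilt_Ginf l0); apply: (filt_Gfilt gF l0).
  exact: (stopping_time_gt gF FT).
split => //; apply: completed_pi_sets_split => //.
have pS : sigma_algebra setT pisc by apply: completion_salg => //; exact: gsalg.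
rewrite beforeE; apply: (salg_bigcup pS) => k; apply: (salg_bigcup_in pS) => l /= kl.
apply: Gfilt_trace_pi_sets; first exact: qenum_ge0.
  exact: mink kl.
exact: GU.2.
Qed.

(** At the first rational time when the version exceeds [1 - 1/(j+1)], the complement of [C] has
    conditional probability at most [1/(j+1)]. So the paths outside [C] that pass all these levels
    form a null set. A value 1 at any time passes every level at a nearby later rational, by
    right-continuity. *)
Lemma split_cprob_one C Y : Ginf Q F tau C -> split_cprob T S Q' C Y ->
  exists2 N, negl Q F tau N & forall w, ~ N w -> forall t, 0 <= t -> active T S t w ->
    Y (tau w, (t, w)) = 1 -> C w.
Proof.
move=> GC [Y01 mY [N nN rY] YC]; have mC := Ginf_measurable GC.
pose B e (t : R) := active T S t `&` [set w | ((1 - e)%:E < (Y (tau w, (t, w)))%:E)%E].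
have GB e (t : R) : 0 <= t -> G t (B e t).
  by move=> t0; exact: (cprob_on_gt (Gs t) (Ga t0) _ (YC t t0)).
pose E j := \bigcup_k B j.+1%:R^-1 (qenum k) `\` C.
have GIS := Ginf_salg Q F tau.
have GE j : Ginf Q F tau (\bigcup_k B j.+1%:R^-1 (qenum k)).
  apply: (salg_bigcup GIS) => k; have k0 := qenum_ge0 k : 0 <= qenum k :> R.
  exact: (Gfilt_Ginf k0 (GB _ _ k0)).
have nE : negl Q F tau (\bigcap_j E j).
  apply: (Q'_negl gF mtau sH).
    by apply: (salg_bigcap GIS) => j; exact: (salg_setD GIS).
  apply: pr_bigcap0 => [j|e e0].
    by apply: measurableD => //; exact: (Ginf_measurable (GE j)).
  have [j je] := ltr_add_invr e0; exists j.
  have j0 : 0 < j.+1%:R^-1 :> R by rewrite invr_gt0.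
  have := @first_time_inequality _ _ Oinf Q' G (fun t _ => Gs t) GM
    (fun s t _ => @Gfilt_le _ _ _ Q F tau s t) (B j.+1%:R^-1) (~` C) setT 1 j.+1%:R^-1
    (measurableC mC) measurableT ltr01 (ltW j0) (GB _).
  rewrite setIT mul1r => /(_ _)/wrap[].
    move=> t A t0 GA AB; rewrite setIT mul1r -setDE.
    have mA := GM t0 GA.
    have h : (1 - j.+1%:R^-1) * pr Q' A <= pr Q' (A `&` C).
      apply: (cprob_on_ge_pr (Gs t) (GM t0) (Ga t0) mC (YC t t0)) => //.
      - by rewrite subr_ge0 invf_le1// ler1n.
      - by move=> w /AB[].
      - by move=> w /AB[_ /ltW].
    by move: h; rewrite (pr_split Q' mA mC) mulrBl mul1r lerBlDr lerD2l.
  rewrite -setDE => /le_trans; apply; apply: le_trans (ltW je).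
  rewrite add0r -[leRHS]mulr1 ler_wpM2l ?(ltW j0)// pr_le1//.
  exact: (Ginf_measurable (GE j)).
exists (N `|` \bigcap_j E j); first exact: negl_setU.
move=> w nw t t0 It Y1; have nNw : ~ N w by move=> Nw; apply: nw; left.
apply: contrapT => nC; apply: nw; right => j _; split => //.
(* Half of the margin, because the level has to be exceeded strictly. *)
have j20 : 0 < j.+1%:R^-1 / 2 :> R by rewrite divr_gt0// invr_gt0.
have [r r0 rt] := rY w nNw t t0 It _ j20; have [r' r'0 rI] := active_right It.
have [|k /andP[tk]] := @qenum_dense _ t (Num.min (t + r) (t + r')) t0.
  by rewrite lt_min !ltrDl r0.
rewrite lt_min => /andP[kr kr'].
have Ik : active T S (qenum k) w by apply: rI; rewrite tk.
exists k => //; split => //=; rewrite lte_fin.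
have := rt (qenum k); rewrite tk kr Y1 => /(_ isT Ik).
rewrite ler_distl => /andP[+ _]; apply: lt_le_trans.
rewrite ltrD2l ltrN2 ltr_pdivrMr// ltr_pMr ?ltr1n//.
Qed.

(** For a rational [k <= q], the event [{U <= k}] within [active k] is in [G k] and contained in
    [before q], so the version is 1 there almost surely. Going back to [t] uses rationals between
    [t] and [q], hence [t < q]. *)
Lemma before_one (q : R) Y : 0 <= q -> Ginf Q F tau (before q) ->
  split_cprob T S Q' (before q) Y ->
  exists2 N, negl Q F tau N & forall w, ~ N w -> forall t, 0 <= t -> active T S t w ->
    (U w <= t%:E)%E -> t < q -> Y (tau w, (t, w)) = 1.
Proof.
move=> q0 Gq [Y01 mY [N nN rY] YC]; have mq := Ginf_measurable Gq.
pose E k := if qenum k <= q then [set w | (U w <= (qenum k)%:E)%E] `&` active T S (qenum k)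
  `&` [set w | ((Y (tau w, (qenum k, w)))%:E < 1%:E)%E] else set0.
have nE k : negl Q F tau (E k).
  rewrite /E; case: ifPn => kq; last exact: negl_set0.
  have k0 := qenum_ge0 k : 0 <= qenum k :> R.
  have GA := salg_setI (Gs (qenum k)) (GU.2 _ k0) (Ga k0).
  apply: (Q'_negl gF mtau sH).
    have GIS := Ginf_salg Q F tau.
    have := salg_setD GIS (Gfilt_Ginf k0 GA)
      (Gfilt_Ginf k0 (cprob_on_ge (Gs (qenum k)) (Ga k0) 1 (YC _ k0))).
    congr (Ginf Q F tau _); apply/seteqP; split => w /=.
      move=> [[Uk Ik] nYk]; split => //; rewrite ltNge; apply/negP => Yk.
      by apply: nYk.
    by move=> [[Uk Ik] Yk]; split => // -[_]; rewrite leNgt Yk.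
  apply: (cprob_on_lt0 (Gs (qenum k)) (GM k0) (Ga k0) mq (YC _ k0)) => //.
  move=> A GA' AB; rewrite mul1r (setIidl _)// => w /AB[Uk [_ kT]]; split.
    by apply: le_trans Uk _; rewrite lee_fin.
  exact: le_lt_trans Uk kT.
exists (N `|` \bigcup_k E k).
  by apply: negl_setU => //; exact: negl_bigcup.
move=> w nw t t0 It Ut tq; have nNw : ~ N w by move=> Nw; apply: nw; left.
apply/eqP; rewrite -subr_eq0 -normr_le0; apply/ler_addgt0Pr => e e0; rewrite add0r.
have [r r0 rt] := rY w nNw t t0 It _ e0; have [r' r'0 rI] := active_right It.
have [|k /andP[tk]] := @qenum_dense _ t (Num.min q (Num.min (t + r) (t + r'))) t0.
  by rewrite !lt_min tq !ltrDl r0.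
rewrite !lt_min => /and3P[kq kr kr'].
have Ik : active T S (qenum k) w by apply: rI; rewrite tk.
have := rt (qenum k); rewrite tk kr => /(_ isT Ik).
suff -> : Y (tau w, (qenum k, w)) = 1 by rewrite distrC.
apply/eqP; rewrite eq_le; apply/andP; split.
  by case/andP: (Y01 (tau w, (qenum k, w))).
rewrite leNgt; apply/negP => Yk; apply: nw; right; exists k => //.
rewrite /E (ltW kq); split => //; split => //=.
by apply: le_trans Ut _; rewrite lee_fin ltW.
Qed.

Lemma stochastic_interval_split : exists E, BOT F E /\
  exists2 N, negl Q F tau N & forall w, ~ N w -> forall t, 0 <= t -> active T S t w ->
    ((U w <= t%:E)%E <-> E (tau w, (t, w))).
Proof.
have /choice[Y YP] k : exists Y, split_cprob T S Q' (before (qenum k)) Y.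
  by case: (before_split (qenum_ge0 k)).
have Gq k : Ginf Q F tau (before (qenum k)) by case: (before_split (qenum_ge0 k)).
have /choice[N NP] k : exists N, negl Q F tau N /\ forall w, ~ N w -> forall t, 0 <= t ->
    active T S t w -> Y k (tau w, (t, w)) = 1 -> before (qenum k) w.
  by have [N nN NP] := split_cprob_one (Gq k) (YP k); exists N.
have /choice[M MP] k : exists M, negl Q F tau M /\ forall w, ~ M w -> forall t, 0 <= t ->
    active T S t w -> (U w <= t%:E)%E -> t < qenum k -> Y k (tau w, (t, w)) = 1.
  by have [M nM MP] := before_one (qenum_ge0 k) (Gq k) (YP k); exists M.
have BS := BOT_salg F.
(* The condition [Y k = 1] is imposed only for rationals after the current time; the other part
   comes from constant stopping times. *)
exists (\bigcap_k ([set p | qenum k <= p.2.1] `|` Y k @^-1` [set 1])); split.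
  apply: (salg_bigcap BS) => k; apply: (salg_setU BS).
    rewrite /BOT /= (_ : Dprod `&` _ = [set p | [set u | (0 <= u)%E] p.1 /\
        [set p | 0 <= p.1 /\ ((qenum k)%:E <= p.1%:E)%E] p.2]).
      apply: sub_sigma_algebra; eexists; eexists; split; last (split; last (split; last reflexivity)).
      + by rewrite -[X in measurable X]setTI; exact: emeasurable_fun_c_infty.
      + by [].
      apply: sub_sigma_algebra; exists (fun=> (qenum k)%:E) => //.
      split; first by move=> w; rewrite lee_fin qenum_ge0.
      move=> t t0; have Ft := filt_salg gF t0; have [kt|kt] := leP (qenum k) t.
        by rewrite (_ : mkset _ = setT); [exact: (salg_setT Ft)|apply/seteqP; split].
      rewrite (_ : mkset _ = set0); first exact: (salg_set0 Ft).
      by apply/seteqP; split => // w /=; rewrite lee_fin leNgt kt.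
    by apply/seteqP; split => p /=; rewrite lee_fin; [move=> [[]]|move=> [? []]].
  apply/measurable_gsalgE => //; rewrite -[X in measurable X]setTI.
  by have [_ mY _ _] := YP k; exact: mY.
exists (\bigcup_k (N k `|` M k)).
  apply: negl_bigcup => // k; apply: negl_setU => //; [by case: (NP k)|by case: (MP k)].
move=> w nw t t0 It; split.
  move=> Ut k _; have [kt|tk] := leP (qenum k) t; first by left.
  right => /=; have [_ ] := MP k; apply => //.
  by move=> Mw; apply: nw; exists k => //; right.
move=> Ew; apply/lee_addgt0Pr => e e0.
have [|k /andP[tk ke]] := @qenum_dense _ t (t + e) t0; first by rewrite ltrDl.
have [/=|Yk] := Ew k I; first by rewrite leNgt tk.
have nNk : ~ N k w by move=> Nw; apply: nw; exists k => //; left.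
have [_ /(_ w nNk t t0 It Yk)[Uk _]] := NP k.
by apply: le_trans Uk _; rewrite -EFinD lee_fin ltW.
Qed.

End optional_splitting.

(** * From split sets to split processes *)

(** Signed rationals, unlike [qenum]: they are levels of a real process, not times. *)
Definition rat_seq (R : realType) (n : nat) : R := ratr (odflt (0 : rat) (unpickle n)).

(** Rebuilds a number from the levels below it; [-oo] is the neutral value for the other levels. *)
Lemma ereal_sup_rat_lt (R : realType) (y : R) :
  ereal_sup (range (fun n => if rat_seq R n < y then (rat_seq R n)%:E else -oo%E)) = y%:E.
Proof.
apply/eqP; rewrite eq_le; apply/andP; split.
  by apply: ge_ereal_sup => _ [n _ <-]; case: ifPn => ny; rewrite ?leNye// lee_fin ltW.
apply/lee_subgt0Pr => e e0.
have [q] := @rat_in_itvoo R (y - e) y (ltac:(by rewrite ltrBlDr ltrDl)).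
rewrite in_itv /= => /andP[eq qy].
apply: (@le_trans _ _ (ratr q)%:E); first by rewrite -EFinB lee_fin ltW.
apply: ereal_sup_ubound; exists (pickle q) => //.
by rewrite /rat_seq pickleK /= qy.
Qed.

Theorem mainTheorem11 (R : realType) (d : measure_display) (Omega : measurableType d)
  (Q : probability Omega R) (F : R -> set (set Omega)) (tau : Omega -> \bar R)
  (T S : Omega -> \bar R) :
  good_filtration Q F ->
  measurable_fun setT tau -> (forall w, (0 <= tau w)%E) ->
  stopping_time F T ->
  stopping_time (Gfilt Q F tau) S ->
  Qnull Q [set w | (S w < tau w)%E] ->
  (exists Q' : probability (g_sigma_algebraType (Ginf Q F tau)) R,
      sH_measure Q F tau S T Q') ->
  Lo Q F tau [set p | 0 <= p.1 /\ (S p.2 <= p.1%:E)%E /\ (p.1%:E < T p.2)%E].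
Proof.
move=> gF mtau tau0 FT GS Stau [Q' sH].
have tauS : negl Q F tau [set w | (S w < tau w)%E].
  (* The hypothesis only gives a measurable null cover. Membership in [Ginf], obtained by putting a
     rational between [S] and [tau], upgrades it to [negl]. *)
  suff GSt : Ginf Q F tau [set w | (S w < tau w)%E].
    exact: (Ginf_Qnull_negl gF mtau GSt Stau).
  have GIS := Ginf_salg Q F tau.
  have -> : [set w | (S w < tau w)%E] =
      \bigcup_k ([set w | (S w <= (qenum k)%:E)%E] `&` [set w | ((qenum k)%:E < tau w)%E]).
    apply/seteqP; split => w /=; last by move=> [k _ [/= Sk kt]]; exact: le_lt_trans Sk kt.
    have S0 := GS.1 w; move: S0; case Sw : (S w) => [x||] // x0 xt; last first.
      by move: xt; rewrite ltNge leey.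
    have [y xy yt] : exists2 y, x < y & (y%:E <= tau w)%E.
      move: xt; case: (tau w) => [y||] //; rewrite ?lte_fin => xy; first by exists y.
      by exists (x + 1); rewrite ?leey// ltrDl.
    have [k /andP[xk ky]] := qenum_dense (x0 : 0 <= x) xy.
    exists k => //; split => /=; first by rewrite Sw lee_fin ltW.
    by apply: lt_le_trans yt; rewrite lte_fin.
  apply: (salg_bigcup GIS) => k; have k0 := qenum_ge0 k : 0 <= qenum k :> R.
  apply: (salg_setI GIS); first exact: (Gfilt_Ginf k0 (GS.2 _ k0)).
  apply: (terminal_Ginf gF); apply: sigma_rv_terminal.
  exists [set x | ((qenum k)%:E < x)%E]; split => //.
  by rewrite -[X in measurable X]setTI; exact: emeasurable_fun_o_infty.
set A := mkset _.
have oS := smallest_sigma_algebra Dpos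
  [set [set p | 0 <= p.1 /\ (S p.2 <= p.1%:E)%E] | S in stopping_time (Gfilt Q F tau)].
split; first by move=> p [].
split.
  have gen U : stopping_time (Gfilt Q F tau) U ->
      optional (Gfilt Q F tau) (Dpos `&` [set p | (U p.2 <= p.1%:E)%E]).
    by move=> GU; apply: sub_sigma_algebra; exists U.
  have := salg_setD (trace_salg oS) (gen _ GS) (gen _ (stopping_time_Gfilt tau gF FT)).
  rewrite /mkset; congr (optional _ _); apply/seteqP; split => -[t w] /=.
    by move=> [t0 [St /negP]]; rewrite -ltNge.
  by move=> [t0 [St]]; rewrite ltNge => /negP.
pose splits (B : set (R * Omega)) (E : set (\bar R * (R * Omega))) (N : set Omega) :=
  [/\ BOT F E, negl Q F tau N & forall w, ~ N w -> forall t, 0 <= t -> active T S t w ->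
    (B (t, w) <-> E (tau w, (t, w)))].
have BS := BOT_salg F.
have opt B : optional (Gfilt Q F tau) B -> exists EN, splits B EN.1 EN.2.
  apply: (gsalg_sub (C := [set B | exists EN, splits B EN.1 EN.2])).
    split.
    - by exists (set0, set0); split => //; [exact: (salg_set0 BS)|exact: negl_set0].
    - move=> B1 [[E N] [/= BE nN NBE]]; exists (~` E, N); split => //.
        exact: (salg_setC BS).
      move=> w nw t t0 It; have := NBE w nw t t0 It => BEw; split.
        by move=> [_ nB] /BEw.
      by move=> nE; split => // /BEw.
    - move=> B1 /choice[EN ENP].
      exists (\bigcup_n (EN n).1, \bigcup_n (EN n).2); split => /=.
      + by apply: (salg_bigcup BS) => n; case: (ENP n).
      + by apply: negl_bigcup => // n; case: (ENP n).
      move=> w nw t t0 It; split => -[n _ h]; exists n => //; have [_ _ hn] := ENP n.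
        by apply/hn => // Nw; apply: nw; exists n.
      by apply/hn => // Nw; apply: nw; exists n.
  move=> _ [U GU <-].
  have [E [BE [N nN NP]]] := stochastic_interval_split gF mtau FT GS tauS sH GU.
  exists (E, N); split => //= w nw t t0 It; have [h1 h2] := NP w nw t t0 It.
  by split => [[_ /h1]|/h2].
move=> Y mY.
have mYn n : exists EN, splits [set p | 0 <= p.1 /\ rat_seq R n < Y p] EN.1 EN.2.
  apply: opt; have := mY `]rat_seq R n, +oo[%classic (measurable_itv _).
  congr (optional _ _); apply/seteqP; split => p /=; rewrite /Dpos /= in_itv /= andbT//.
move: mYn => /choice[EN ENP].
(* The level sets of [Y] are optional, hence split by the sets [(EN n).1]; [Y''] is the supremum of
   the levels whose set contains the point. Where this supremum is infinite, [fine] returns 0; on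
   [[S, T)] outside the null set it is the finite value of [Y]. *)
pose f n (p : \bar R * (R * Omega)) : \bar R :=
  if p \in (EN n).1 then (rat_seq R n)%:E else -oo%E.
pose Y'' p := fine (ereal_sup (range (f^~ p))).
(* On [[S, T)], outside the null set, [tau <= S <= t], so the indicator of the time before [tau]
   vanishes and [Y'] can be taken zero. *)
exists (cst 0), Y''; split.
  move=> B mB; have [B0|nB0] := pselect (B 0).
    rewrite (_ : Dpos `&` _ = Dpos `\` set0); last by rewrite setD0; apply/seteqP; split => // p [].
    by apply: sigma_algebraCD; exact: sigma_algebra0.
  rewrite (_ : Dpos `&` _ = set0); first exact: sigma_algebra0.
  by apply/seteqP; split => // p [].
split.
  have mf n : @measurable_fun _ _ (g_sigma_algebraType (BOT F)) _ setT (f n).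
    have mE : @measurable _ (g_sigma_algebraType (BOT F)) (EN n).1.
      by apply/measurable_gsalgE => //; case: (ENP n).
    apply: measurable_fun_ifT => //.
    apply: (@measurable_fun_bool _ (g_sigma_algebraType (BOT F)) setT _ true).
    rewrite setTI (_ : _ @^-1` _ = (EN n).1)//.
    by apply/seteqP; split => p /=; [move=> /set_mem|move=> /mem_set].
  have mY'' : @measurable_fun _ _ (g_sigma_algebraType (BOT F)) R setT Y''.
    apply: measurableT_comp; first exact: fine_measurable.
    have := measurable_fun_esups mf 0%N.
    congr (measurable_fun _ _); apply/funext => p; congr (ereal_sup _).
    by apply/seteqP; split => _ [n] /= _ <-; exists n.
  move=> B mB; suff : BOT F (Y'' @^-1` B) by [].
  apply/measurable_gsalgE => //; rewrite -[X in measurable X]setTI.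
  exact: mY''.
pose M := [set w | (S w < tau w)%E] `|` \bigcup_n (EN n).2.
have nM : negl Q F tau M.
  by apply: negl_setU => //; apply: negl_bigcup => // n; case: (ENP n).
exists M; split; first exact: (negl_Nsig gF mtau).
split; first exact: (negl_Qnull gF mtau).
move=> w nMw t t0; have [Aw|nA] := pselect (A (t, w)); last first.
  by rewrite ![\1_A _]indicE memNset// !mulr0.
rewrite ![\1_A _]indicE mem_set// !mulr1 mul0r add0r.
have [_ [/= St tT]] := Aw.
have tauSw : (tau w <= S w)%E by rewrite leNgt; apply/negP => h; apply: nMw; left.
rewrite indicE mem_set ?mulr1; last by rewrite /= (le_trans tauSw).
rewrite /Y'' -[LHS]/(fine (Y (t, w))%:E) -(ereal_sup_rat_lt (Y (t, w))).
congr (fine (ereal_sup _)); apply/seteqP.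
have fE n : f n (tau w, (t, w)) = if rat_seq R n < Y (t, w) then (rat_seq R n)%:E else -oo%E.
  rewrite /f; have [_ _ h] := ENP n.
  have {h} := h w (fun Nw => nMw (or_intror (ex_intro2 _ _ n I Nw))) t t0 (conj St tT).
  move=> /= h; congr (if _ then _ else _); apply/idP/idP.
    by move=> /set_mem /h[].
  by move=> hr; apply/mem_set/h.
by split => _ [n _ <-]; exists n => //; rewrite fE.
Qed.
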